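(* Let $(Z_t:t\ge0)\subset\Omega$ be a reversible, time-homogeneous Markov process with stationary probability measure $\mu$ on a Polish space $\Omega$, which satisfies a trace Poincaré inequality with some constant $\alpha>0$. Let $\varphi:\mathbb R\to\mathbb R$ be a differentiable scalar function whose squared derivative $\psi=(\varphi')^2$ is convex. Then $$\operatorname{tr}\boldsymbol{\mathcal E}(\varphi(\boldsymbol f)) = \mathbb E_\mu\operatorname{tr}\boldsymbol\Gamma(\varphi(\boldsymbol f)) \le \mathbb E_\mu\operatorname{tr}\big[\boldsymbol\Gamma(\boldsymbol f)\,\psi(\boldsymbol f)\big]\quad\text{for all suitable }\boldsymbol f:\Omega\to\mathbb H_d.$$ In particular, $$\operatorname{tr}\boldsymbol{\mathcal E}(\varphi(\boldsymbol g)) = \mathbb E_{\mu\otimes\mu}\operatorname{tr}\boldsymbol\Gamma(\varphi(\boldsymbol g)) \le \mathbb E_{\mu\otimes\mu}\operatorname{tr}\big[\boldsymbol\Gamma(\boldsymbol g)\,\psi(\boldsymbol g)\big]\quad\text{for all suitable }\boldsymbol g:\Omega^2\to\mathbb H_d.$$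
   Context: Notation. $\mathbb H_d$ is the real linear space of $d\times d$ self-adjoint complex matrices, $\mathbb H_d^+$ its cone of positive-semidefinite matrices, $\|\cdot\|$ the operator norm, $\operatorname{tr}$ the ordinary trace. A scalar function acts on $\mathbb H_d$ through the spectral resolution; such functions bind before trace and expectation. Univariate carré du champ and Dirichlet form, for $\boldsymbol f:\Omega\to\mathbb H_d$: $$\boldsymbol\Gamma(\boldsymbol f)(z):=\lim_{t\downarrow0}\tfrac1{2t}\,\mathbb E\big[(\boldsymbol f(Z_t)-\boldsymbol f(Z_0))^2\,\big|\,Z_0=z\big]\in\mathbb H_d^+,$$ $$\boldsymbol{\mathcal E}(\boldsymbol f):=\lim_{t\downarrow0}\tfrac1{2t}\,\mathbb E_{Z\sim\mu}\big[(\boldsymbol f(Z_t)-\boldsymbol f(Z_0))^2\,\big|\,Z_0=Z\big]\in\mathbb H_d^+$$ (in the second formula the process is started from $\mu$). Bivariate versions, for $\boldsymbol g:\Omega^2\to\mathbb H_d$: $$\boldsymbol\Gamma_1(\boldsymbol g)(z_1,z_2):=\lim_{t\downarrow0}\tfrac1{2t}\,\mathbb E\big[(\boldsymbol g(Z_t,z_2)-\boldsymbol g(Z_0,z_2))^2\,\big|\,Z_0=z_1\big],$$ $$\boldsymbol{\mathcal E}_1(\boldsymbol g)(z_2):=\lim_{t\downarrow0}\tfrac1{2t}\,\mathbb E_{Z\sim\mu}\big[(\boldsymbol g(Z_t,z_2)-\boldsymbol g(Z_0,z_2))^2\,\big|\,Z_0=Z\big],$$ with analogous definitions of $\boldsymbol\Gamma_2(\boldsymbol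 g)$, $\boldsymbol{\mathcal E}_2(\boldsymbol g)$ for the second coordinate, and $$\boldsymbol\Gamma(\boldsymbol g):=\boldsymbol\Gamma_1(\boldsymbol g)+\boldsymbol\Gamma_2(\boldsymbol g),\qquad \boldsymbol{\mathcal E}(\boldsymbol g):=\mathbb E_{\mu\otimes\mu}\big[\boldsymbol{\mathcal E}_1(\boldsymbol g)+\boldsymbol{\mathcal E}_2(\boldsymbol g)\big].$$ Trace Poincaré inequality with constant $\alpha$ (a standing assumption of the paper): $\operatorname{tr}\mathbb E_\mu[(\boldsymbol f-\mathbb E_\mu\boldsymbol f)^2]\le\alpha\operatorname{tr}\boldsymbol{\mathcal E}(\boldsymbol f)$ for all $d\in\mathbb N$ and all regular $\boldsymbol f:\Omega\to\mathbb H_d$. Regularity convention. The paper restricts throughout to a ''nice'' class of functions for which the limit defining $\boldsymbol\Gamma$ exists pointwise and in $L_1(\mu)$ and for which manipulations of expectations, limits and derivatives are justified. Concretely: $\boldsymbol f$ on $\Omega$ is regular if it is measurable, $\mathbb E_\mu\|\boldsymbol f\|^2<\infty$, and the limit defining $\boldsymbol\Gamma(\boldsymbol f)$ exists pointwise and in $L_1(\mu)$; $\boldsymbol g$ on $\Omega^2$ is regular if it is square integrable for $\mu\otimes\mu$, is regular in each coordinate when the other is fixed, and its limits $\boldsymbol\Gamma_1(\boldsymbol g),\boldsymbol\Gamma_2(\boldsymbol g)$ also converge in $L_1(\mu\otimes\mu)$. ''Suitable'' (relative to $\varphi$) means: $\boldsymbol f$ and $\varphi(\boldsymbol f)$ are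 regular, and $\operatorname{tr}\big[\tfrac1{2t}\mathbb E[(\boldsymbol f(Z_t)-\boldsymbol f(Z_0))^2\mid Z_0=z]\,\psi(\boldsymbol f(z))\big]\to\operatorname{tr}[\boldsymbol\Gamma(\boldsymbol f)(z)\psi(\boldsymbol f(z))]$ in $L_1(\mu)$ as $t\downarrow0$; for $\boldsymbol g$ on $\Omega^2$, that $\boldsymbol g$ and $\varphi(\boldsymbol g)$ are regular, and the analogous convergence holds for each of the two coordinates, both when the other coordinate is fixed (in $L_1(\mu)$) and jointly (in $L_1(\mu\otimes\mu)$). *)

(* Defs.v *)
From HB Require Import structures.
From mathcomp Require Import all_boot all_order all_algebra.
From mathcomp Require Import all_classical all_reals all_analysis.
From mathcomp Require Import complex.
Set Implicit Arguments.
Unset Strict Implicit.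
Unset Printing Implicit Defensive.
Import Order.TTheory GRing.Theory Num.Theory.
Import numFieldNormedType.Exports.
Local Open Scope classical_set_scope.
Local Open Scope ring_scope.
Local Open Scope complex_scope.

(* Usual topology of the complex field, so that limits of complex matrices are
   the entrywise ones of the library. *)
HB.instance Definition _ (R : rcfType) := PseudoPointedMetric.copy R[i] R[i]^o.

Definition polish (R : realType) (T : topologicalType) : Prop :=
  (exists2 S : set T, countable S & dense S) /\
  exists dist : T -> T -> R,
    [/\ forall x y, 0 <= dist x y /\ (dist x y = 0 <-> x = y),
        forall x y, dist x y = dist y x,
        forall x y z, dist x z <= dist x y + dist y z,
        forall x (A : set T),
          nbhs x A <-> exists2 e, 0 < e & [set y | dist x y < e] `<=` A
      & forall u : nat -> T,
          (forall e, 0 < e -> exists N : nat, forall m n : nat,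
             (N <= m)%N -> (N <= n)%N -> dist (u m) (u n) < e) ->
          exists l : T, u n @[n --> \oo] --> l].

Notation borel T := (g_sigma_algebraType (@open T)).

Section matrices.
Context {R : realType} {n : nat}.
Implicit Types A : 'M[R[i]]_n.

Definition l2norm (x : 'cV[R[i]]_n) : R :=
  Num.sqrt (\sum_(k < n) (complex.Re (x k 0) ^+ 2 + complex.Im (x k 0) ^+ 2)).

Definition opnorm A : R :=
  sup [set l2norm (A *m x) | x in [set x : 'cV[R[i]]_n | l2norm x <= 1]].

(* The matrices whose trace is taken below are Hermitian, or products of two
   Hermitian matrices, so that their trace is real. *)
Definition rtr A : R := complex.Re (\tr A).

(* The library decomposition of a normal matrix reads
   A = invmx (spectralmx A) *m diag_mx (spectral_diag A) *m spectralmx A,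
   with real spectral_diag A when A is Hermitian. *)
Definition mxfun (phi : R -> R) A : 'M[R[i]]_n :=
  invmx (spectralmx A)
  *m diag_mx (map_mx (fun x => (phi (complex.Re x))%:C) (spectral_diag A))
  *m spectralmx A.

End matrices.

Section matrix_integration.
Context {R : realType} {d : measure_display} {T : measurableType d} {n : nat}.
Implicit Types (m : {measure set T -> \bar R}) (F : T -> 'M[R[i]]_n).

Definition mx_measurable F : Prop := forall i j,
  measurable_fun setT (fun x => complex.Re (F x i j)) /\
  measurable_fun setT (fun x => complex.Im (F x i j)).

Definition mx_integrable m F : Prop :=
  mx_measurable F /\ (\int[m]_x (opnorm (F x))%:E < +oo)%E.

Definition mx_expect m F : 'M[R[i]]_n :=
  \matrix_(i, j) ((\int[m]_x complex.Re (F x i j)) +i*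
                  (\int[m]_x complex.Im (F x i j))).

(* Convergence in L_1 as t decreases to 0; the functions are required to lie in
   L_1, for t small enough. *)
Definition mx_cvgL1 m (h : R -> T -> 'M[R[i]]_n) (l : T -> 'M[R[i]]_n) : Prop :=
  [/\ \forall t \near 0^'+, mx_integrable m (h t),
      mx_integrable m l
    & (\int[m]_x (opnorm (h t x - l x))%:E)%E @[t --> 0^'+] --> 0%E].

Definition cvgL1 m (h : R -> T -> R) (l : T -> R) : Prop :=
  [/\ \forall t \near 0^'+, m.-integrable setT (EFin \o h t),
      m.-integrable setT (EFin \o l)
    & (\int[m]_x `|h t x - l x|%:E)%E @[t --> 0^'+] --> 0%E].

End matrix_integration.

(* A Markov process is given by random variables Z t, t >= 0, on a path space W
   (Z t is irrelevant for t < 0) and by the family of laws Pr z on W of the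
   process started at Z_0 = z; E[ . | Z_0 = z] is the integral for Pr z. *)
Section markov.
Context {R : realType} {d dW : measure_display}.
Context {T : measurableType d} {W : measurableType dW}.
Context (Pr : R.-pker T ~> W) (Z : R -> W -> T) (mu : probability T R).

Definition past (s : R) : set (set W) :=
  <<s [set A | exists u B,
        [/\ 0 <= u, u <= s, measurable B & A = Z u @^-1` B]] >>.

Definition markov_process : Prop :=
  [/\ forall t, 0 <= t -> measurable_fun setT (Z t),
      forall z B, measurable B -> Pr z (Z 0 @^-1` B) = \d_z B
    & forall z s t A B, 0 <= s -> 0 <= t -> past s A -> measurable B ->
        Pr z (A `&` Z (s + t) @^-1` B) =
        (\int[Pr z]_(w in A) Pr (Z s w) (Z t @^-1` B))%E].

(* Law of the process started from Z_0 ~ mu: A |-> \int[mu]_z Pr z A. *)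
Definition start_law : {measure set W -> \bar R} :=
  mkcomp_noparam
    (kprobability (measurable_cst (mu : pprobability T R) : measurable_fun [set: unit] _))
    Pr tt.

Definition stationary : Prop := forall t B, 0 <= t -> measurable B ->
  start_law (Z t @^-1` B) = mu B.

Definition reversible : Prop := forall t A B, 0 <= t ->
  measurable A -> measurable B ->
  start_law (Z 0 @^-1` A `&` Z t @^-1` B) =
  start_law (Z 0 @^-1` B `&` Z t @^-1` A).

Section univariate.
Context {n : nat}.
Implicit Types f : T -> 'M[R[i]]_n.

Definition sq_increment f (t : R) (w : W) : 'M[R[i]]_n :=
  (f (Z t w) - f (Z 0 w)) *m (f (Z t w) - f (Z 0 w)).

Definition carre_approx f (t : R) (z : T) : 'M[R[i]]_n :=
  ((2 * t)^-1)%:C *: mx_expect (Pr z) (sq_increment f t).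

Definition carre_du_champ f (z : T) : 'M[R[i]]_n :=
  lim (carre_approx f t z @[t --> 0^'+]).

Definition dirichlet f : 'M[R[i]]_n :=
  lim (((2 * t)^-1)%:C *: mx_expect start_law (sq_increment f t) @[t --> 0^'+]).

(* Existence of the limit at z includes that of the conditional expectations
   for small t. *)
Definition regular f : Prop :=
  [/\ forall z, f z \is hermsymmx,
      mx_measurable f,
      (\int[mu]_z (opnorm (f z) ^+ 2)%:E < +oo)%E,
      forall z, (\forall t \near 0^'+, mx_integrable (Pr z) (sq_increment f t)) /\
        cvg (carre_approx f t z @[t --> 0^'+])
    & mx_cvgL1 mu (carre_approx f) (carre_du_champ f)].

Definition carre_fun_cvg (psi : R -> R) f : Prop :=
  cvgL1 mu (fun t z => rtr (carre_approx f t z *m mxfun psi (f z)))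
           (fun z => rtr (carre_du_champ f z *m mxfun psi (f z))).

Definition suitable (phi psi : R -> R) f : Prop :=
  [/\ regular f, regular (mxfun phi \o f) & carre_fun_cvg psi f].

End univariate.

Definition trace_poincare (alpha : R) : Prop :=
  forall (n : nat) (f : T -> 'M[R[i]]_n), regular f ->
    let Ef := mx_expect mu f in
    rtr (mx_expect mu (fun z => (f z - Ef) *m (f z - Ef)))
      <= alpha * rtr (dirichlet f).

Section bivariate.
Context {n : nat}.
Implicit Types g : T * T -> 'M[R[i]]_n.

Definition slice1 g (z2 : T) : T -> 'M[R[i]]_n := fun z1 => g (z1, z2).
Definition slice2 g (z1 : T) : T -> 'M[R[i]]_n := fun z2 => g (z1, z2).

Definition carre_approx1 g t (z : T * T) := carre_approx (slice1 g z.2) t z.1.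
Definition carre_approx2 g t (z : T * T) := carre_approx (slice2 g z.1) t z.2.

Definition carre_du_champ1 g (z : T * T) := carre_du_champ (slice1 g z.2) z.1.
Definition carre_du_champ2 g (z : T * T) := carre_du_champ (slice2 g z.1) z.2.

Definition biv_carre_du_champ g (z : T * T) : 'M[R[i]]_n :=
  carre_du_champ1 g z + carre_du_champ2 g z.

Definition dirichlet1 g (z2 : T) := dirichlet (slice1 g z2).
Definition dirichlet2 g (z1 : T) := dirichlet (slice2 g z1).

Definition biv_dirichlet g : 'M[R[i]]_n :=
  mx_expect (mu \x mu)%E (fun z => dirichlet1 g z.2 + dirichlet2 g z.1).

Definition biv_regular g : Prop :=
  [/\ forall z, g z \is hermsymmx,
      mx_measurable g,
      (\int[mu \x mu]_z (opnorm (g z) ^+ 2)%:E < +oo)%E,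
      (forall z2, regular (slice1 g z2)) /\ (forall z1, regular (slice2 g z1))
    & mx_cvgL1 (mu \x mu)%E (carre_approx1 g) (carre_du_champ1 g) /\
      mx_cvgL1 (mu \x mu)%E (carre_approx2 g) (carre_du_champ2 g)].

Definition biv_suitable (phi psi : R -> R) g : Prop :=
  [/\ biv_regular g, biv_regular (mxfun phi \o g),
      forall z2, carre_fun_cvg psi (slice1 g z2),
      forall z1, carre_fun_cvg psi (slice2 g z1)
    & cvgL1 (mu \x mu)%E
        (fun t z => rtr (carre_approx1 g t z *m mxfun psi (g z)))
        (fun z => rtr (carre_du_champ1 g z *m mxfun psi (g z))) /\
      cvgL1 (mu \x mu)%E
        (fun t z => rtr (carre_approx2 g t z *m mxfun psi (g z)))
        (fun z => rtr (carre_du_champ2 g z *m mxfun psi (g z)))].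

End bivariate.

End markov.

(* Main.v *)
Require Import Defs.
From mathcomp Require Import all_boot all_order all_algebra.
From mathcomp Require Import all_classical all_reals all_analysis.
From mathcomp Require Import measurable_realfun spectral sesquilinear ring lra.
From mathcomp Require Import complex.
Import Order.TTheory GRing.Theory Num.Theory.
Import numFieldNormedType.Exports.
Local Open Scope classical_set_scope.
Local Open Scope ring_scope.

(** Write B = f (Z_0), A = f (Z_t) and psi = (phi')^2.

    Everything rests on the trace inequality
      tr (phi(A) - phi(B))^2 <= tr ((A - B)^2 (psi(A) + psi(B))) / 2
    for Hermitian A and B ([mean_value_trace_inequality]).  In terms of the
    eigenvalues a_i of A and b_j of B, both sides are sums with the same
    nonnegative weights, the squared overlaps of the eigenvectors
    ([sqr_increment_weights]), so that it reduces to the scalar inequality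
      (phi a - phi b)^2 <= (a - b)^2 (psi a + psi b) / 2
    ([sqr_increment_le]), which is where the convexity of psi enters.

    Start the process from mu and integrate.  By reversibility (Z_0, Z_t) is
    exchangeable ([ge0_integral_reversible]), hence the two terms on the right
    have the same expectation, and
      E tr (phi(A) - phi(B))^2 <= E tr ((A - B)^2 psi(B)).
    Conditioning on Z_0 = z freezes psi(B) at psi(f z): divided by 2t, this is
    the inequality between the integrals over mu of the approximations at time t
    of the two sides ([carre_approx_le]).  All the convergences are in L_1, so
    that t may tend to 0 ([carre_du_champ_chain_le]).  The same computation
    exchanges the limit defining the Dirichlet form with the expectation over
    the starting point ([dirichlet_carre]), which gives the equality.

    In two variables, the univariate results hold on each slice and Fubini
    integrates them over the frozen variable ([rtr_biv_dirichlet],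
    [biv_carre_du_champ_chain_le]).

    Two measure-theoretic points need care.  For a fixed t, the conditional
    second moments of the increment are known to be finite only for almost every
    z: this comes from the square integrability of f and the stationarity of mu
    ([entries_integrable_sq_increment], [ae_integrable_start_law]).  And the
    matrix psi(f z) is a measurable function of z although the spectral
    resolution of f z is chosen without any regularity: the functions h for
    which h(f z) is measurable form an algebra closed under pointwise limits,
    and such an algebra contains every nonnegative Borel function as soon as it
    contains the polynomials ([borel_mem_limit_algebra]). *)

(** * A scalar mean value inequality *)

Section scalar.
Context {R : realType}.

(** The chord bound is the only form in which convexity is used. *)
Lemma convex_le_chord (psi : R -> R) (a b x : R) : convex_function (setT : set R^o) psi ->
  a < b -> a <= x -> x <= b ->
  psi x <= psi a + (x - a) / (b - a) * (psi b - psi a).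
Proof.
move=> cpsi ab ax xb; have ba : 0 < b - a by rewrite subr_gt0.
have t0 : 0 <= (b - x) / (b - a) by rewrite divr_ge0 ?subr_ge0 // ltW.
have t1 : (b - x) / (b - a) <= 1.
  by rewrite ler_pdivrMr // mul1r lerD2l lerN2.
pose t : {i01 R} := Itv01 t0 t1.
have : psi ((b - x) / (b - a) * a + (1 - (b - x) / (b - a)) * b) <=
    (b - x) / (b - a) * psi a + (1 - (b - x) / (b - a)) * psi b.
  by apply: (cpsi t a b); rewrite inE.
have -> : (b - x) / (b - a) * a + (1 - (b - x) / (b - a)) * b = x.
  by field; lra.
move=> /le_trans; apply; rewrite le_eqVlt; apply/orP; left; apply/eqP.
by field; lra.
Qed.

(** Under the chord L of psi on [a, b], the AM-GM inequality gives
    phi' <= (L / c + c) / 2, whose right-hand side has a quadratic primitive H;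
    the mean value theorem for phi - H then stands for the integration of
    phi' along [a, b]. *)
Lemma increment_le (phi psi : R -> R) (a b c : R) :
  (forall x : R, derivable phi x 1) ->
  (forall x, (derive1 phi x) ^+ 2 = psi x) ->
  convex_function (setT : set R^o) psi -> a < b -> 0 < c ->
  phi b - phi a <= (b - a) * ((psi a + psi b) / 2 / c + c) / 2.
Proof.
move=> dphi psiE cpsi ab c0.
have ba : 0 < b - a by rewrite subr_gt0.
pose s := (psi b - psi a) / (b - a).
(* H is a primitive of (L / c + c) / 2, where L is the chord of psi. *)
pose H x : R := ((x - a) * psi a + (x - a) ^+ 2 * (s / 2)) / c / 2 + x * (c / 2).
pose dH x : R := (psi a + (x - a) * s) / c / 2 + c / 2.
have dHE x : is_derive x (1 : R) H (dH x).
  rewrite /H; apply: is_derive_eq; rewrite /dH.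
  rewrite /GRing.scale /= /s; field; lra.
have dpE x : is_derive x (1 : R) phi (derive1 phi x).
  by rewrite derive1E; apply: DeriveDef.
have dD x : is_derive x (1 : R) (phi - H) (derive1 phi x - dH x).
  exact: is_deriveB.
have [|y /andP[ay yb]] := @MVT R (phi - H) _ a b ab (fun x _ => dD x).
  apply: continuous_subspaceT => x.
  by apply: differentiable_continuous; apply/derivable1_diffP; case: (dD x).
rewrite !bnd_simp in ay yb.
have le0 : derive1 phi y - dH y <= 0.
  have := convex_le_chord psi a b y cpsi ab (ltW ay) (ltW yb).
  rewrite -psiE => hle.
  have -> : dH y = ((psi a + (y - a) / (b - a) * (psi b - psi a)) + c ^+ 2) / (2 * c).
    by rewrite /dH /s; field; lra.
  rewrite subr_le0 ler_pdivlMr; last by lra.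
  apply: le_trans (_ : (derive1 phi y) ^+ 2 + c ^+ 2 <= _); last by rewrite lerD2r.
  by have := sqr_ge0 (derive1 phi y - c); nra.
move=> E; have : (phi - H) b - (phi - H) a <= 0.
  by rewrite E mulr_le0_ge0 // ltW.
rewrite /= !fctE /H.
have -> : (b - a) * ((psi a + psi b) / 2 / c + c) / 2 =
  ((b - a) * psi a + (b - a) ^+ 2 * (s / 2)) / c / 2 + b * (c / 2)
  - (((a - a) * psi a + (a - a) ^+ 2 * (s / 2)) / c / 2 + a * (c / 2)).
  by rewrite /s; field; lra.
lra.
Qed.

(** The Hermite-Hadamard bound for psi combined with Cauchy-Schwarz for the
    integral of phi'; [increment_le] with a good choice of c stands for both. *)
Lemma sqr_increment_le (phi psi : R -> R) (a b : R) :
  (forall x : R, derivable phi x 1) ->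
  (forall x, (derive1 phi x) ^+ 2 = psi x) ->
  convex_function (setT : set R^o) psi ->
  (phi a - phi b) ^+ 2 <= (a - b) ^+ 2 * ((psi a + psi b) / 2).
Proof.
move=> dphi psiE cpsi.
wlog ab : a b / a < b.
  move=> H; have [ab|ba|->] := ltgtP a b; first exact: H.
  - have := H _ _ ba.
    by rewrite -(opprB (phi a)) -(opprB a) !sqrrN (addrC (psi b)).
  - by rewrite !subrr expr0n /= mul0r.
have ba : 0 < b - a by rewrite subr_gt0.
have [->|ne] := eqVneq (phi a) (phi b).
  rewrite subrr expr0n mulr_ge0 // ?sqr_ge0 // divr_ge0 //.
  by rewrite -!psiE addr_ge0 ?sqr_ge0.
(* With c the absolute slope q of phi on [a, b], increment_le reads
   q <= (m / q + q) / 2 where m is the mean of psi a and psi b, i.e. q^2 <= m. *)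
pose q := `|phi b - phi a| / (b - a).
have q0 : 0 < q by rewrite divr_gt0 // normr_gt0 subr_eq0 eq_sym.
have dN : forall x : R, derivable (- phi) x 1 by move=> x; exact: derivableN.
have dNE x : derive1 (- phi) x ^+ 2 = psi x.
  by rewrite derive1E deriveN // -derive1E sqrrN.
have h1 := increment_le phi psi a b q dphi psiE cpsi ab q0.
have h2 := increment_le (- phi) psi a b q dN dNE cpsi ab q0.
have h : `|phi b - phi a| <= (b - a) * ((psi a + psi b) / 2 / q + q) / 2.
  rewrite ler_norml h1 andbT lerNl; apply: le_trans h2.
  by rewrite !fctE; lra.
have XE : `|phi b - phi a| = q * (b - a) by rewrite /q; field; lra.
have : q ^+ 2 <= (psi a + psi b) / 2.
  have {}h : q <= ((psi a + psi b) / 2 / q + q) / 2.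
    rewrite -(ler_pM2r ba) -XE; apply: le_trans h _.
    by rewrite le_eqVlt; apply/orP; left; apply/eqP; ring.
  have : q * q <= ((psi a + psi b) / 2 / q + q) / 2 * q.
    by rewrite ler_pM2r.
  have -> : ((psi a + psi b) / 2 / q + q) / 2 * q =
     ((psi a + psi b) / 2 + q * q) / 2 by field; lra.
  by rewrite expr2; lra.
rewrite -(opprB (phi b)) -(opprB b) !sqrrN -(@real_normK _ (phi b - _)) ?num_real //.
move=> hq; rewrite XE exprMn (mulrC (q ^+ 2)).
by rewrite ler_wpM2l ?sqr_ge0.
Qed.
End scalar.

(** * Joint spectral resolution of two Hermitian matrices *)

Section unitary_diagonalization.
Context {C : numClosedFieldType} {n : nat}.
Implicit Types (U V : 'M[C]_n) (d e : 'rV[C]_n).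

Lemma conj_diag_mxM U d e : U \in unitmx ->
  (invmx U *m diag_mx d *m U) *m (invmx U *m diag_mx e *m U) =
  invmx U *m diag_mx (\row_j (d 0 j * e 0 j)) *m U.
Proof.
move=> uU; rewrite !mulmxA mulmxK // -(mulmxA (invmx U)) mulmx_diag.
by congr (_ *m diag_mx _ *m _); apply/rowP => j; rewrite !mxE.
Qed.

Lemma unitary_overlap_conj U V i j : U \is unitarymx -> V \is unitarymx ->
  (V *m invmx U) j i = ((U *m invmx V) i j)^*%R.
Proof.
move=> uU uV; rewrite !invmx_unitary // !mxE rmorph_sum.
apply: eq_bigr => l _; rewrite !mxE rmorphM /= conjCK mulrC.
by [].
Qed.

(** Here W i j is the inner product of the i-th eigenvector of the first matrix
    with the j-th eigenvector of the second one. *)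
Lemma mxtrace_conj_diag_mxM U V d e : U \is unitarymx -> V \is unitarymx ->
  let W := U *m invmx V in
  \tr ((invmx U *m diag_mx d *m U) *m (invmx V *m diag_mx e *m V)) =
  \sum_i \sum_j (d 0 i * e 0 j) * (W i j * (W i j)^*%R).
Proof.
move=> uU uV W; rewrite -!mulmxA mxtrace_mulC -!mulmxA (mulmxA U) -/W.
apply: eq_bigr => i _; rewrite mul_diag_mx mxE [X in _ * X]mxE mulr_sumr.
apply: eq_bigr => j _; rewrite mul_diag_mx [X in _ * (_ * X) = _]mxE
    (unitary_overlap_conj U V i j uU uV) -/W.
by ring.
Qed.

End unitary_diagonalization.

Section trace_expansion.
Context {C : comNzRingType} {n : nat}.
Implicit Types (P Q S : 'M[C]_n).

(** When P and S are functions of one matrix and Q is a function of another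
    one, every term becomes the trace of a product of one function of each, which
    the joint spectral resolution evaluates. *)
Lemma mxtrace_sqrB_mull P Q S : \tr ((P - Q) *m (P - Q) *m S) =
  \tr (P *m P *m S) - \tr ((S *m P) *m Q) - \tr ((P *m S) *m Q)
  + \tr (S *m (Q *m Q)).
Proof.
have -> : \tr ((S *m P) *m Q) = \tr (P *m Q *m S).
  by rewrite -mulmxA mxtrace_mulC.
have -> : \tr ((P *m S) *m Q) = \tr (Q *m P *m S).
  by rewrite mxtrace_mulC mulmxA.
rewrite (mxtrace_mulC S) mulmxBl !mulmxBr !mulmxBl !raddfB /=; ring.
Qed.

Lemma mxtrace_sqrB_mulr P Q S : \tr ((P - Q) *m (P - Q) *m S) =
  \tr ((P *m P) *m S) - \tr (P *m (Q *m S)) - \tr (P *m (S *m Q))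
  + \tr (Q *m Q *m S).
Proof.
have -> : \tr (P *m (S *m Q)) = \tr (Q *m P *m S).
  by rewrite mulmxA mxtrace_mulC mulmxA.
by rewrite mulmxA mulmxBl !mulmxBr !mulmxBl !raddfB /=; ring.
Qed.

Lemma sqrmxB_sym P Q : (P - Q) *m (P - Q) = (Q - P) *m (Q - P).
Proof. by rewrite -(opprB Q) mulNmx mulmxN opprK. Qed.

End trace_expansion.

Section spectral.
Local Open Scope complex_scope.
Context {R : realType} {n : nat}.
Implicit Types (A B U V : 'M[R[i]]_n) (h k : R -> R).

(** The same unitary matrix and eigenvalues serve all the functions h at once;
    the proofs below use nothing else about the chosen diagonalization. *)
Lemma spectral_decomposition A : exists U (a : 'I_n -> R), [/\ U \is unitarymx,
  (forall h, mxfun h A = invmx U *m diag_mx (\row_j (h (a j))%:C) *m U)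
  & A \is hermsymmx -> A = invmx U *m diag_mx (\row_j (a j)%:C) *m U].
Proof.
exists (spectralmx A), (fun j => complex.Re (spectral_diag A 0 j)).
split; first exact: spectral_unitarymx.
- move=> h; rewrite /mxfun; move: (spectralmx A) (spectral_diag A) => U d.
  have -> // : map_mx (fun x => (h (complex.Re x))%:C) d =
    \row_j (h (complex.Re (d 0 j)))%:C by apply/rowP => j; rewrite !mxE.
- move=> hA; have /hermitian_normalmx /orthomx_spectralP := hA.
  have := hermitian_spectral_diag_real hA.
  move: (spectralmx A) (spectral_diag A) => U d /mxOverP rd {1}->.
  have -> // : \row_j (complex.Re (d 0 j))%:C = d.
  by apply/rowP => j; rewrite mxE RRe_real.
Qed.

(** The spectral resolution entry by entry: C l is the projection onto the l-th
    eigenvector. *)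
Lemma mxfunE A : exists (C : 'I_n -> 'M[R[i]]_n) (a : 'I_n -> R), forall h i j,
  mxfun h A i j = \sum_l (h (a l))%:C * C l i j.
Proof.
have [U [a [_ E _]]] := spectral_decomposition A.
exists (fun l => \matrix_(i, j) (invmx U i l * U l j)), a => h i j.
rewrite E mul_mx_diag mxE; apply: eq_bigr => l _.
by rewrite !mxE mulrAC mulrC mulrA.
Qed.

Lemma mxfunM h k A : mxfun h A *m mxfun k A = mxfun (fun x => h x * k x) A.
Proof.
have [U [a [uU E _]]] := spectral_decomposition A.
rewrite (E h) (E k) (E (fun x => h x * k x)).
rewrite (conj_diag_mxM U _ _ (unitarymx_unit uU)).
have -> // : \row_j ((\row_j (h (a j))%:C : 'rV[R[i]]_n) 0 j *
   (\row_j (k (a j))%:C : 'rV[R[i]]_n) 0 j) = \row_j (h (a j) * k (a j))%:C.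
by apply/rowP => j; rewrite !mxE rmorphM.
Qed.

Lemma mxfunD h k A : mxfun (fun x => h x + k x) A = mxfun h A + mxfun k A.
Proof.
have [C [a E]] := mxfunE A.
apply/matrixP => i j; rewrite [RHS]mxE.
apply: (etrans (E (fun x => h x + k x) i j)).
apply: etrans (esym (congr2 +%R (E h i j) (E k i j))).
rewrite -big_split; apply: eq_bigr => l _ /=.
by rewrite rmorphD mulrDl.
Qed.

Lemma mxfunZ (c : R) h A : mxfun (fun x => c * h x) A = c%:C *: mxfun h A.
Proof.
have [C [a E]] := mxfunE A.
apply/matrixP => i j; rewrite [RHS]mxE.
apply: (etrans (E (fun x => c * h x) i j)).
apply: etrans (esym (congr1 ( *%R c%:C) (E h i j))).
rewrite mulr_sumr; apply: eq_bigr => l _ /=.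
by rewrite rmorphM -mulrA.
Qed.

Lemma mxfun1 A : mxfun (fun=> 1) A = 1%:M.
Proof.
have [U [a [uU E _]]] := spectral_decomposition A; rewrite E.
have -> : \row_(j < n) (1 : R)%:C = const_mx 1.
  by apply/rowP => j; rewrite !mxE.
by rewrite diag_const_mx mulmx1 mulVmx // unitarymx_unit.
Qed.

Lemma mxfun_id A : A \is hermsymmx -> mxfun id A = A.
Proof.
by have [U [a [_ E hE]]] := spectral_decomposition A => /hE {2}->; rewrite E.
Qed.

(** The weights are the squared moduli of the inner products of the
    eigenvectors of A with those of B; they do not depend on h and k. *)
Lemma joint_spectral_weights A B : exists (w : 'I_n -> 'I_n -> R) (a b : 'I_n -> R),
  (forall i j, 0 <= w i j) /\
  forall h k, rtr (mxfun h A *m mxfun k B) =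
    \sum_i \sum_j w i j * (h (a i) * k (b j)).
Proof.
have [U [a [uU EA _]]] := spectral_decomposition A.
have [V [b [uV EB _]]] := spectral_decomposition B.
pose W := U *m invmx V.
exists (fun i j => complex.Re (W i j * (W i j)^*%R)), a, b; split => [i j|h k].
  by have := mul_conjC_ge0 (W i j); rewrite lecE => /andP[].
rewrite /rtr (EA h) (EB k) (mxtrace_conj_diag_mxM U V _ _ uU uV) -/W.
clearbody W; rewrite raddf_sum; apply: eq_bigr => i _ /=.
rewrite raddf_sum; apply: eq_bigr => j _ /=.
rewrite !mxE -rmorphM.
move: (W i j) => z.
case: (z * z^*%R) => x y; rewrite /=.
by rewrite mul0r subr0 mulrC.
Qed.

Lemma sqr_increment_weights A B :
  exists (w : 'I_n -> 'I_n -> R) (a b : 'I_n -> R), [/\ (forall i j, 0 <= w i j),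
  (forall h k, rtr ((mxfun h A - mxfun h B) *m (mxfun h A - mxfun h B) *m mxfun k A)
     = \sum_i \sum_j w i j * ((h (a i) - h (b j)) ^+ 2 * k (a i))) &
  (forall h k, rtr ((mxfun h A - mxfun h B) *m (mxfun h A - mxfun h B) *m mxfun k B)
     = \sum_i \sum_j w i j * ((h (a i) - h (b j)) ^+ 2 * k (b j)))].
Proof.
have [w [a [b [w0 E]]]] := joint_spectral_weights A B.
exists w, a, b; move: mxfunM mxfun1 E.
(* Only the algebraic rules of the functional calculus matter from here on. *)
generalize (@mxfun R n) => mf mfM mf1 E; split => // h k.
- have := mxtrace_sqrB_mull (mf h A) (mf h B) (mf k A).
  rewrite !mfM.
  have := E (fun x => h x * h x * k x) (fun=> 1).
  rewrite mf1 mulmx1.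
  have := E (fun x => k x * h x) h.
  have := E (fun x => h x * k x) h.
  have := E k (fun x => h x * h x).
  rewrite /rtr => e1 e2 e3 e4 ->.
  rewrite raddfD !raddfB [LHS]/= e1 e2 e3 e4.
  rewrite -!sumrB -big_split /=; apply: eq_bigr => i _.
  by rewrite -!sumrB -big_split /=; apply: eq_bigr => j _; ring.
- have := mxtrace_sqrB_mulr (mf h A) (mf h B) (mf k B).
  rewrite !mfM.
  have := E (fun=> 1) (fun x => h x * h x * k x).
  rewrite mf1 mul1mx.
  have := E h (fun x => k x * h x).
  have := E h (fun x => h x * k x).
  have := E (fun x => h x * h x) k.
  rewrite /rtr => e1 e2 e3 e4 ->.
  rewrite raddfD !raddfB [LHS]/= e1 e2 e3 e4.
  rewrite -!sumrB -big_split /=; apply: eq_bigr => i _.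
  by rewrite -!sumrB -big_split /=; apply: eq_bigr => j _; ring.
Qed.

Lemma rtr_sqrB_mxfun_ge0 k A B : A \is hermsymmx -> B \is hermsymmx ->
  (forall x, 0 <= k x) -> 0 <= rtr ((A - B) *m (A - B) *m mxfun k A).
Proof.
move=> hA hB k0; have [w [a [b [w0 /(_ id k) + _]]]] := sqr_increment_weights A B.
move: (mxfun_id A hA) (mxfun_id B hB); generalize (@mxfun R n) => mf -> -> ->.
do 2!(apply: sumr_ge0 => ? _); apply: mulr_ge0 => //.
by apply: mulr_ge0; rewrite ?sqr_ge0 ?k0.
Qed.

(** Term by term comparison of the two sides, which are sums with the same
    weights over the pairs of eigenvalues of A and B. *)
Lemma mean_value_trace_inequality (phi psi : R -> R) A B :
  (forall x : R, derivable phi x 1) ->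
  (forall x, (derive1 phi x) ^+ 2 = psi x) ->
  convex_function (setT : set R^o) psi ->
  A \is hermsymmx -> B \is hermsymmx ->
  rtr ((mxfun phi A - mxfun phi B) *m (mxfun phi A - mxfun phi B)) <=
  (rtr ((A - B) *m (A - B) *m mxfun psi A) +
   rtr ((A - B) *m (A - B) *m mxfun psi B)) / 2.
Proof.
move=> dphi psiE cpsi hA hB.
have [w [a [b [w0 EA EB]]]] := sqr_increment_weights A B.
have := EB id psi; have := EA id psi; have := EA phi (fun=> 1).
move: (mxfun1 A) (mxfun_id A hA) (mxfun_id B hB).
generalize (@mxfun R n) => mf -> -> ->.
rewrite mulmx1 => -> -> ->.
rewrite -big_split mulr_suml; apply: ler_sum => i _ /=.
rewrite -big_split mulr_suml; apply: ler_sum => j _ /=.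
rewrite -mulrDr -mulrA ler_wpM2l // mulr1 -mulrDr -mulrA.
exact: sqr_increment_le.
Qed.
End spectral.

(** * Borel functions of measurable Hermitian matrices *)

Section limit_algebra.
Context {R : realType}.
Variable K : (R -> R) -> Prop.
Hypothesis Kcst : forall c, K (fun=> c).
Hypothesis Kid : K id.
Hypothesis KD : forall h k, K h -> K k -> K (fun x => h x + k x).
Hypothesis KM : forall h k, K h -> K k -> K (fun x => h x * k x).
Hypothesis Klim : forall (h_ : nat -> R -> R) h, (forall m, K (h_ m)) ->
  (forall x, h_ m x @[m --> \oo] --> h x) -> K h.

Let KN h : K h -> K (fun x => - h x).
Proof.
move=> Kh; have := KM _ _ (Kcst (-1)) Kh; congr K.
by apply/funext => x; rewrite mulN1r.
Qed.

Let Ksum (I : Type) (s : seq I) (h : I -> R -> R) : (forall i, K (h i)) ->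
  K (fun x => \sum_(i <- s) h i x).
Proof.
move=> Kh; elim: s => [|i s IH].
  by under eq_fun do rewrite big_nil; exact: Kcst.
by under eq_fun do rewrite big_cons; exact: KD.
Qed.

Let KX h m : K h -> K (fun x => h x ^+ m).
Proof.
move=> Kh; elim: m => [|m IH]; first by under eq_fun do rewrite expr0; exact: Kcst.
by under eq_fun do rewrite exprS; exact: KM.
Qed.

Let Kexp h : K h -> K (fun x => expR (h x)).
Proof.
move=> Kh; apply: (Klim (fun m x => series (exp_coeff (h x)) m)) => [m|x].
  apply: Ksum => j; rewrite /exp_coeff /=.
  by apply: KM; [exact: KX|exact: Kcst].
exact: is_cvg_series_exp_coeff.
Qed.

(* exp (- y^m) with y = exp (c - x) tends to 1, exp (-1) or 0 according to the
   position of x with respect to c; the powers of this limit erase the middle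
   value. *)
Let Kray c : K \1_(`]c, +oo[%classic : set R).
Proof.
pose L (x : R) : R := if c < x then 1 else if x == c then expR (-1) else 0.
have KL : K L.
  apply: (Klim (fun m x => expR (- (expR (c - x)) ^+ m))) => [m|x].
    apply: Kexp; apply: KN; apply: KX; apply: Kexp; apply: KD; first exact: Kcst.
    exact: KN.
  rewrite /L; have [cx|xc|<-] := ltgtP c x.
  - rewrite -[X in _ --> X](expR0 R) -oppr0; apply: continuous_cvg.
      exact: continuous_expR.
    apply: cvgN; apply: cvg_expr.
    by rewrite ger0_norm ?expR_ge0 // expR_lt1 subr_lt0.
  - apply: (@squeeze_cvgr _ _ _ _ (fun=> 0) (fun m => (expR (x - c)) ^+ m)).
    + near=> m; rewrite expR_ge0 /=.
      have -> : expR (x - c) ^+ m = (expR (c - x) ^+ m)^-1.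
        by rewrite -exprVn -expRN opprB.
      rewrite expRN lef_pV2 ?posrE ?expR_gt0 ?exprn_gt0 ?expR_gt0 //.
      by apply: le_trans (expR_ge1Dx _); rewrite lerDr.
    + exact: cvg_cst.
    + by apply: cvg_expr; rewrite ger0_norm ?expR_ge0 // expR_lt1 subr_lt0.
  - rewrite subrr expR0; under eq_fun do rewrite expr1n; exact: cvg_cst.
apply: (Klim (fun m x => L x ^+ m.+1)) => [m|x]; first exact: KX.
rewrite indicE mem_setE /L in_itv /= andbT; have [cx|xc|_] := ltgtP c x.
- by under eq_fun do rewrite expr1n; exact: cvg_cst.
- by under eq_fun do rewrite expr0n; exact: cvg_cst.
- have : (expR (-1) : R) ^+ m @[m --> \oo] --> (0 : R).
    apply: cvg_expr; rewrite ger0_norm ?expR_ge0 // expR_lt1 ltrN10.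
  by rewrite -cvg_shiftS.
Unshelve. all: by end_near. Qed.

Let K_set (B : set R) : measurable B -> K \1_B.
Proof.
rewrite -[measurable B]/((@ocitv R).-sigma.-measurable B) RGenOInfty.measurableE.
apply: (smallest_sub (C := sigma_algebra setT) (X := fun B => K \1_B)); last first.
  by move=> _ [c ->]; exact: Kray.
split=> [|A KA|F KF].
- by rewrite indic0; exact: Kcst.
- rewrite setTD; have -> : \1_(~` A) = (fun x => 1 + - \1_A x) :> (R -> R).
    by apply/funext => x; rewrite !indicE in_setC; case: (x \in A) => /=; ring.
  by apply: KD; [exact: Kcst|exact: KN].
- pose P m (x : R) : R := \prod_(i < m) (1 - \1_(F i) x).
  have KP m : K (P m).
    rewrite /P; elim: m => [|m IH].
      by under eq_fun do rewrite big_ord0; exact: Kcst.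
    under eq_fun do rewrite big_ord_recr /=; apply: KM => //.
    by apply: KD; [exact: Kcst|exact: KN].
  have -> : \1_(\bigcup_k F k) = (fun x => 1 + - (\1_(~` \bigcup_k F k) x)) :> (R -> R).
    by apply/funext => x; rewrite !indicE in_setC; case: (x \in _) => /=; ring.
  apply: KD; [exact: Kcst|apply: KN; apply: (Klim P) => // x].
  rewrite indicE in_setC; case: (pselect ((\bigcup_k F k) x)) => [[k _ Fkx]|nF].
    have -> : x \in \bigcup_k F k by rewrite inE; exists k.
    apply: cvg_near_cst; near=> m.
    have km : (k < m)%N by near: m; exact: nbhs_infty_gt.
    rewrite /P (bigD1 (Ordinal km)) //= indicE mem_set // subrr mul0r //.
  rewrite memNset //=; apply: cvg_near_cst; apply: nearW => m.
  rewrite /P big1 // => i _; rewrite indicE memNset ?subr0 // => Fi; apply: nF.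
  by exists (val i).
Unshelve. all: by end_near. Qed.

Import HBNNSimple.

(** The algebra contains the exponentials of its elements (partial sums of the
    series), hence the indicators of the rays ]c, +oo[ as limits of iterated
    exponentials, hence those of all Borel sets (they form a sigma-algebra), and
    finally the limits of simple functions. *)
Lemma borel_mem_limit_algebra (psi : R -> R) : measurable_fun [set: R] psi ->
  (forall x, 0 <= psi x) -> K psi.
Proof.
move=> mpsi psi0.
have mE : measurable_fun [set: R] (EFin \o psi) by exact/measurable_EFinP.
pose g := nnsfun_approx measurableT mE.
apply: (Klim (fun m x => g m x)) => [m|x].
  have -> : (fun x => g m x) =
    (fun x => \sum_(y \in range (g m)) y * \1_(g m @^-1` [set y]) x).
    by apply/funext => x; rewrite fimfunE.
  under eq_fun do rewrite fsbig_finite //=.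
  apply: Ksum => y; apply: KM; first exact: Kcst.
  by apply: K_set; exact: measurable_funPTI.
have := @cvg_nnsfun_approx _ _ _ _ measurableT _ mE
    (fun x _ => psi0 x : (0 <= (psi x)%:E)%E) x Logic.I.
by move/fine_cvgP => [].
Qed.
End limit_algebra.

Section complex_parts.
Local Open Scope complex_scope.
Context {R : realType}.
Implicit Types x y : R[i].

Lemma cReD x y : complex.Re (x + y) = complex.Re x + complex.Re y.
Proof. exact: raddfD. Qed.
Lemma cImD x y : complex.Im (x + y) = complex.Im x + complex.Im y.
Proof. exact: raddfD. Qed.
Lemma cReN x : complex.Re (- x) = - complex.Re x.
Proof. exact: raddfN. Qed.
Lemma cImN x : complex.Im (- x) = - complex.Im x.
Proof. exact: raddfN. Qed.
Lemma cRe_sum (I : Type) (r : seq I) (F : I -> R[i]) :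
  complex.Re (\sum_(i <- r) F i) = \sum_(i <- r) complex.Re (F i).
Proof. exact: raddf_sum. Qed.
Lemma cIm_sum (I : Type) (r : seq I) (F : I -> R[i]) :
  complex.Im (\sum_(i <- r) F i) = \sum_(i <- r) complex.Im (F i).
Proof. exact: raddf_sum. Qed.
Lemma cReM x y : complex.Re (x * y) =
  complex.Re x * complex.Re y - complex.Im x * complex.Im y.
Proof. by case: x y => [a b] [c d]. Qed.
Lemma cImM x y : complex.Im (x * y) =
  complex.Re x * complex.Im y + complex.Im x * complex.Re y.
Proof. by case: x y => [a b] [c d]. Qed.
Lemma cReZ (c : R) x : complex.Re (c%:C * x) = c * complex.Re x.
Proof. by rewrite cReM /= mul0r subr0. Qed.
Lemma cImZ (c : R) x : complex.Im (c%:C * x) = c * complex.Im x.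
Proof. by rewrite cImM /= mul0r addr0. Qed.
End complex_parts.

Section real_trace.
Local Open Scope complex_scope.
Context {R : realType} {n : nat}.
Implicit Types A B : 'M[R[i]]_n.

Lemma rtrD A B : rtr (A + B) = rtr A + rtr B.
Proof. by rewrite /rtr raddfD cReD. Qed.

Lemma rtrZ (c : R) A : rtr (c%:C *: A) = c * rtr A.
Proof. by rewrite /rtr mxtraceZ cReZ. Qed.

End real_trace.

Section measurability.
Local Open Scope complex_scope.
Context {R : realType} {d : measure_display} {T : measurableType d} {n : nat}.
Implicit Types F G : T -> 'M[R[i]]_n.

Lemma mx_measurableD F G : mx_measurable F -> mx_measurable G ->
  mx_measurable (fun x => F x + G x).
Proof.
move=> mF mG i j; have [mF1 mF2] := mF i j; have [mG1 mG2] := mG i j; split.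
- by under eq_fun do rewrite mxE cReD; exact: measurable_funD.
- by under eq_fun do rewrite mxE cImD; exact: measurable_funD.
Qed.

Lemma mx_measurableB F G : mx_measurable F -> mx_measurable G ->
  mx_measurable (fun x => F x - G x).
Proof.
move=> mF mG i j; have [mF1 mF2] := mF i j; have [mG1 mG2] := mG i j; split.
- by under eq_fun do rewrite !mxE cReD cReN; exact: measurable_funB.
- by under eq_fun do rewrite !mxE cImD cImN; exact: measurable_funB.
Qed.

Lemma mx_measurableM F G : mx_measurable F -> mx_measurable G ->
  mx_measurable (fun x => F x *m G x).
Proof.
move=> mF mG i j; split.
- under eq_fun do rewrite mxE cRe_sum; apply: measurable_sum => l.
  under eq_fun do rewrite cReM.
  have [mF1 mF2] := mF i l; have [mG1 mG2] := mG l j.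
  by apply: measurable_funB; exact: measurable_funM.
- under eq_fun do rewrite mxE cIm_sum; apply: measurable_sum => l.
  under eq_fun do rewrite cImM.
  have [mF1 mF2] := mF i l; have [mG1 mG2] := mG l j.
  by apply: measurable_funD; exact: measurable_funM.
Qed.

Lemma mx_measurable_cst (A : 'M[R[i]]_n) : mx_measurable (fun _ : T => A).
Proof. by move=> i j; split. Qed.

Lemma measurable_rtr F : mx_measurable F -> measurable_fun setT (fun x => rtr (F x)).
Proof.
move=> mF; rewrite /rtr /mxtrace.
under eq_fun do rewrite cRe_sum; apply: measurable_sum => l.
by have [] := mF l l.
Qed.

(** On a given matrix, functional calculus only sees the values of the
    function at finitely many eigenvalues. *)
Lemma cvg_mxfun (h_ : nat -> R -> R) (h : R -> R) (A : 'M[R[i]]_n) i j :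
  (forall x, h_ m x @[m --> \oo] --> h x) ->
  complex.Re (mxfun (h_ m) A i j) @[m --> \oo] --> complex.Re (mxfun h A i j) /\
  complex.Im (mxfun (h_ m) A i j) @[m --> \oo] --> complex.Im (mxfun h A i j).
Proof.
move=> h_h; have [C [a E]] := mxfunE A.
have ReE k : complex.Re (mxfun k A i j) = \sum_l k (a l) * complex.Re (C l i j).
  by rewrite E cRe_sum; under eq_bigr do rewrite cReZ.
have ImE k : complex.Im (mxfun k A i j) = \sum_l k (a l) * complex.Im (C l i j).
  by rewrite E cIm_sum; under eq_bigr do rewrite cImZ.
split.
- rewrite (funext (fun m => ReE (h_ m))) ReE.
  by apply: cvg_big => // [|l _];
    [exact: add_continuous|apply: cvgM; [exact: h_h|exact: cvg_cst]].
- rewrite (funext (fun m => ImE (h_ m))) ImE.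
  by apply: cvg_big => // [|l _];
    [exact: add_continuous|apply: cvgM; [exact: h_h|exact: cvg_cst]].
Qed.

(** The eigenvectors and eigenvalues of F x are not known to depend measurably
    on x; the claim is obtained from polynomials, for which it is clear, by
    algebraic operations and pointwise limits. *)
Lemma measurable_mxfun (psi : R -> R) F : (forall x, F x \is hermsymmx) ->
  mx_measurable F -> measurable_fun [set: R] psi -> (forall x, 0 <= psi x) ->
  mx_measurable (fun x => mxfun psi (F x)).
Proof.
move=> hF mF mpsi psi0.
refine (borel_mem_limit_algebra (fun h => mx_measurable (fun x => mxfun h (F x)))
  _ _ _ _ _ psi mpsi psi0).
- move=> c.
  have -> : (fun x => mxfun (fun=> c) (F x)) = fun=> c%:C *: 1%:M.
    apply/funext => x; rewrite -(mxfun1 (F x)).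
    apply: etrans (mxfunZ c (fun=> 1) (F x)).
    by congr mxfun; apply/funext => y; rewrite mulr1.
  exact: mx_measurable_cst.
- have -> // : (fun x => mxfun id (F x)) = F by apply/funext => x; exact: mxfun_id.
- move=> h k mh mk.
  have -> : (fun x => mxfun (fun y => h y + k y) (F x)) =
     fun x => mxfun h (F x) + mxfun k (F x) by apply/funext => x; exact: mxfunD.
  exact: mx_measurableD.
- move=> h k mh mk.
  have -> : (fun x => mxfun (fun y => h y * k y) (F x)) =
     fun x => mxfun h (F x) *m mxfun k (F x).
    by apply/funext => x; apply/esym; exact: mxfunM.
  exact: mx_measurableM.
- move=> h_ h mh h_h i j; split.
  + apply: (@measurable_fun_cvg _ _ _ setT (fun m x => complex.Re (mxfun (h_ m) (F x) i j))).
      by move=> m; exact: (mh m i j).1.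
    by move=> x _; exact: (cvg_mxfun h_ h (F x) i j h_h).1.
  + apply: (@measurable_fun_cvg _ _ _ setT (fun m x => complex.Im (mxfun (h_ m) (F x) i j))).
      by move=> m; exact: (mh m i j).2.
    by move=> x _; exact: (cvg_mxfun h_ h (F x) i j h_h).2.
Qed.
End measurability.

(** * Integrals and limits of complex matrices *)

Section opnorm.
Context {R : realType} {n : nat}.
Implicit Types (A : 'M[R[i]]_n) (x : 'cV[R[i]]_n).

Lemma normr_Re_le_l2norm x k : `|complex.Re (x k 0)| <= l2norm x.
Proof.
rewrite -sqrtr_sqr ler_wsqrtr // (bigD1 k) //= -addrA lerDl addr_ge0 ?sqr_ge0 //.
by apply: sumr_ge0 => l _; rewrite addr_ge0 ?sqr_ge0.
Qed.

Lemma normr_Im_le_l2norm x k : `|complex.Im (x k 0)| <= l2norm x.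
Proof.
rewrite -sqrtr_sqr ler_wsqrtr // (bigD1 k) //= addrAC lerDr addr_ge0 ?sqr_ge0 //.
by apply: sumr_ge0 => l _; rewrite addr_ge0 ?sqr_ge0.
Qed.

(** Without this bound the supremum defining the operator norm would carry no
    information. *)
Lemma l2norm_mulmx_bounded A :
  exists M : R, forall x, l2norm x <= 1 -> l2norm (A *m x) <= M.
Proof.
pose c k : R := \sum_j (`|complex.Re (A k j)| + `|complex.Im (A k j)|).
exists (Num.sqrt (\sum_k (c k ^+ 2 + c k ^+ 2))) => x x1.
rewrite ler_wsqrtr //; apply: ler_sum => k _.
have c0 : 0 <= c k by apply: sumr_ge0 => l _; rewrite addr_ge0.
have Rex l : `|complex.Re (x l 0)| <= 1 by apply: le_trans x1; exact: normr_Re_le_l2norm.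
have Imx l : `|complex.Im (x l 0)| <= 1 by apply: le_trans x1; exact: normr_Im_le_l2norm.
have sq (u v : R) : `|u| <= v -> u ^+ 2 <= v ^+ 2.
  by move=> uv; rewrite -real_normK ?num_real // lerXn2r ?nnegrE // (le_trans _ uv).
apply: lerD; apply: sq; rewrite mxE ?cRe_sum ?cIm_sum;
  (apply: le_trans (ler_norm_sum _ _ _) _; apply: ler_sum => l _).
- rewrite cReM; apply: le_trans (ler_normB _ _) _.
  by apply: lerD; rewrite normrM ler_piMr.
- rewrite cImM; apply: le_trans (ler_normD _ _) _.
  by apply: lerD; rewrite normrM ler_piMr.
Qed.

Lemma l2norm_mulmx_le_opnorm A x : l2norm x <= 1 -> l2norm (A *m x) <= opnorm A.
Proof.
move=> x1; apply: ub_le_sup; last by exists x.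
by have [M hM] := l2norm_mulmx_bounded A; exists M => _ [y y1 <-]; exact: hM.
Qed.

Lemma opnorm_ge0 A : 0 <= opnorm A.
Proof.
apply: le_trans (l2norm_mulmx_le_opnorm A 0 _); first exact: sqrtr_ge0.
rewrite /l2norm big1 ?sqrtr0 // => k _.
by rewrite mxE /= expr0n /= addr0.
Qed.

Lemma l2norm_delta j : l2norm (delta_mx j 0 : 'cV[R[i]]_n) <= 1.
Proof.
rewrite /l2norm (bigD1 j) //= big1 ?mxE ?eqxx /=.
  by rewrite !expr0n expr1n !addr0 sqrtr1.
move=> k kj; rewrite mxE (negbTE kj) /= !expr0n addr0 //.
Qed.

Lemma mulmx_delta A k j : (A *m delta_mx j 0 : 'cV_n) k 0 = A k j.
Proof. by rewrite -colE mxE. Qed.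

Lemma normr_Re_le_opnorm A k j : `|complex.Re (A k j)| <= opnorm A.
Proof.
rewrite -mulmx_delta; apply: le_trans (normr_Re_le_l2norm _ _) _.
exact/l2norm_mulmx_le_opnorm/l2norm_delta.
Qed.

Lemma normr_Im_le_opnorm A k j : `|complex.Im (A k j)| <= opnorm A.
Proof.
rewrite -mulmx_delta; apply: le_trans (normr_Im_le_l2norm _ _) _.
exact/l2norm_mulmx_le_opnorm/l2norm_delta.
Qed.

End opnorm.

Section integration.
Context {R : realType} {d : measure_display} {T : measurableType d}.
Variable m : {measure set T -> \bar R}.
Implicit Types (f g : T -> R).

(** The integral of a nonnegative function is a supremum over the simple
    functions below it, hence monotone on arbitrary functions; g will be an
    operator norm. *)
Lemma ge0_le_integral_nonmeasurable (f g : T -> \bar R) :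
  (forall x, 0 <= f x)%E -> (forall x, f x <= g x)%E ->
  (\int[m]_x f x <= \int[m]_x g x)%E.
Proof.
move=> f0 fg; rewrite !ge0_integralE //; last by move=> x _; exact: le_trans (fg x).
rewrite !patch_setT; apply: le_ereal_sup => _ [h /= hf <-]; exists h => //= x.
exact: le_trans (hf x) (fg x).
Qed.

Lemma integrable_le_nonmeasurable f (g : T -> R) : measurable_fun setT f ->
  (forall x, `|f x| <= g x) -> (\int[m]_x (g x)%:E < +oo)%E ->
  m.-integrable setT (EFin \o f).
Proof.
move=> mf fg goo; apply/integrableP; split; first exact/measurable_EFinP.
apply: le_lt_trans goo; apply: ge0_le_integral_nonmeasurable => x //=.
by rewrite lee_fin.
Qed.

Lemma cvgL1_Rintegral (h : R -> T -> R) (l : T -> R) : cvgL1 m h l ->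
  \int[m]_x h t x @[t --> 0^'+] --> \int[m]_x l x.
Proof.
move=> [hint lint hl].
have /fine_cvgP [_ hl'] := hl.
apply/cvgrPdist_le => e e0.
have /cvgrPdist_le/(_ _ e0) := hl'.
move: hint; apply: filterS2 => t ht.
rewrite sub0r normrN => hte.
rewrite distrC -RintegralB //.
apply: le_trans hte; apply: le_trans (ler_norm _).
have hlint : m.-integrable setT (EFin \o (fun x => h t x - l x)).
  by apply: eq_integrable (integrableB measurableT ht lint).
exact: le_normr_Rintegral.
Qed.

Context {n : nat}.
Implicit Types F : T -> 'M[R[i]]_n.

Lemma mx_integrable_Re F i j : mx_integrable m F ->
  m.-integrable setT (EFin \o fun x => complex.Re (F x i j)).
Proof.
move=> [mF Foo]; apply: integrable_le_nonmeasurable Foo.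
  by have [] := mF i j.
by move=> x; exact: normr_Re_le_opnorm.
Qed.

Lemma mx_integrable_Im F i j : mx_integrable m F ->
  m.-integrable setT (EFin \o fun x => complex.Im (F x i j)).
Proof.
move=> [mF Foo]; apply: integrable_le_nonmeasurable Foo.
  by have [] := mF i j.
by move=> x; exact: normr_Im_le_opnorm.
Qed.

Lemma mx_cvgL1_entries h (l : T -> 'M[R[i]]_n) i j : mx_cvgL1 m h l ->
  cvgL1 m (fun t x => complex.Re (h t x i j)) (fun x => complex.Re (l x i j)) /\
  cvgL1 m (fun t x => complex.Im (h t x i j)) (fun x => complex.Im (l x i j)).
Proof.
move=> [hint lint hl]; split; split.
- by apply: filterS hint => t; exact: mx_integrable_Re.
- exact: mx_integrable_Re.
- apply: (@squeeze_cvge _ _ _ _ (fun=> 0%E) _ _ _ _ _ hl); last exact: cvg_cst.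
  apply: nearW => t; apply/andP; split; first by apply: integral_ge0 => x _; rewrite lee_fin.
  apply: ge0_le_integral_nonmeasurable => x; rewrite lee_fin //.
  by rewrite -cReN -cReD; apply: le_trans (normr_Re_le_opnorm _ i j); rewrite !mxE.
- by apply: filterS hint => t; exact: mx_integrable_Im.
- exact: mx_integrable_Im.
- apply: (@squeeze_cvge _ _ _ _ (fun=> 0%E) _ _ _ _ _ hl); last exact: cvg_cst.
  apply: nearW => t; apply/andP; split; first by apply: integral_ge0 => x _; rewrite lee_fin.
  apply: ge0_le_integral_nonmeasurable => x; rewrite lee_fin //.
  by rewrite -cImN -cImD; apply: le_trans (normr_Im_le_opnorm _ i j); rewrite !mxE.
Qed.
End integration.

Section complex_matrix_limits.
Local Open Scope complex_scope.
Context {R : realType} {n : nat}.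

Lemma complex_hausdorff : hausdorff_space (R[i] : topologicalType).
Proof. exact: (@norm_hausdorff _ (R[i]^o)). Qed.

(** Limits of matrices are unique: two entrywise limits can be separated on one
    coordinate. *)
Lemma cmx_hausdorff : hausdorff_space ('M[R[i]]_n : topologicalType).
Proof.
move=> p q pq; apply/matrixP => i j; apply: complex_hausdorff => A B pA qB.
pose S (C : set R[i]) := [set M : 'M[R[i]]_n | C (M i j)].
have nbhsS (M : 'M[R[i]]_n) (C : set R[i]) : nbhs (M i j) C -> nbhs M (S C).
  move=> MC; exists (fun k l => if (k == i) && (l == j) then C else setT).
    move=> k l; case: ifP => [/andP[/eqP -> /eqP ->] //|_]; exact: filterT.
  by move=> N /(_ i j); rewrite !eqxx.
by have [M [SA SB]] := pq _ _ (nbhsS _ _ pA) (nbhsS _ _ qB); exists (M i j).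
Qed.

Lemma cvg_complex {T} (F : set_system T) {FF : Filter F} (u : T -> R[i]) (z : R[i]) :
  complex.Re (u t) @[t --> F] --> complex.Re z ->
  complex.Im (u t) @[t --> F] --> complex.Im z ->
  u t @[t --> F] --> z.
Proof.
move=> /cvgrPdist_lt cRe /cvgrPdist_lt cIm A /nbhs_ballP [e /= e0 eA].
have [r r0 er] : exists2 r : R, 0 < r & e = r%:C.
  move: e0; rewrite ltcE /= => /andP[/eqP Ie Re0]; exists (complex.Re e) => //.
  by case: e Ie {Re0 eA} => a b /= ->.
have r20 : 0 < r / 2 by rewrite divr_gt0.
have {}cRe := cRe _ r20; have {}cIm := cIm _ r20.
suff : \forall t \near F, A (u t) by [].
move: cRe cIm; apply: filterS2 => t hR hI; apply: eA.
change (`|z - u t| < e).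
rewrite er normc_def ltcR cReD cReN cImD cImN.
move: (_ - _) (_ - _) hR hI => a b ha hb.
rewrite -[ltRHS]gtr0_norm // -sqrtr_sqr ltr_sqrt ?exprn_gt0 //.
have sq (v : R) : `|v| < r / 2 -> v ^+ 2 < (r / 2) ^+ 2.
  by move=> vr; rewrite -real_normK ?num_real // ltrXn2r ?nnegrE // ltW.
have := sq _ ha; have := sq _ hb; nra.
Qed.

Lemma lim_cmx {T} (F : set_system T) {FF : ProperFilter F} (h : T -> 'M[R[i]]_n)
    (L : 'M[R[i]]_n) :
  (forall i j, complex.Re (h t i j) @[t --> F] --> complex.Re (L i j)) ->
  (forall i j, complex.Im (h t i j) @[t --> F] --> complex.Im (L i j)) ->
  lim (h t @[t --> F]) = L.
Proof.
move=> hRe hIm; apply: cvg_lim; first exact: cmx_hausdorff.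
move=> A [P PL PA].
have : \forall t \near F, forall i j, P i j (h t i j).
  do 2!(apply: filter_forall => ?); exact: (cvg_complex _ _ _ (hRe _ _) (hIm _ _)).
by apply: filterS => t Pt; exact: PA.
Qed.

End complex_matrix_limits.

Section entries_integrable.
Context {R : realType} {d : measure_display} {T : measurableType d}.
Variable m : {measure set T -> \bar R}.

Lemma Rintegral_sum (I : Type) (s : seq I) (f : I -> T -> R) :
  (forall i, m.-integrable setT (EFin \o f i)) ->
  m.-integrable setT (EFin \o (fun x => \sum_(i <- s) f i x)) /\
  \int[m]_x (\sum_(i <- s) f i x) = \sum_(i <- s) \int[m]_x f i x.
Proof.
move=> fi; elim: s => [|i s [IHi IHE]].
  under eq_fun do rewrite big_nil; rewrite big_nil; split.
    exact: integrable0.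
  by rewrite /Rintegral integral0.
have E : (fun x => \sum_(j <- i :: s) f j x) = (fun x => f i x + \sum_(j <- s) f j x).
  by apply/funext => x; rewrite big_cons.
rewrite E big_cons; split.
  by apply: eq_integrable (integrableD measurableT (fi i) IHi).
by rewrite RintegralD // IHE.
Qed.

Context {n : nat}.
Implicit Types (F S : T -> 'M[R[i]]_n) (M : 'M[R[i]]_n).

Definition entries_integrable S := forall i j,
  m.-integrable setT (EFin \o fun x => complex.Re (S x i j)) /\
  m.-integrable setT (EFin \o fun x => complex.Im (S x i j)).

Lemma mx_integrable_entries S : mx_integrable m S -> entries_integrable S.
Proof. by move=> iS i j; split; [exact: mx_integrable_Re|exact: mx_integrable_Im]. Qed.

Lemma rtr_mulmx (X M : 'M[R[i]]_n) : rtr (X *m M) =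
  \sum_i \sum_j (complex.Re (X i j) * complex.Re (M j i)
                - complex.Im (X i j) * complex.Im (M j i)).
Proof.
rewrite /rtr /mxtrace cRe_sum; apply: eq_bigr => i _.
by rewrite mxE cRe_sum; apply: eq_bigr => j _; rewrite cReM.
Qed.

Lemma rtr_mx_expect_mulmx S M : entries_integrable S ->
  m.-integrable setT (EFin \o (fun x => rtr (S x *m M))) /\
  rtr (mx_expect m S *m M) = \int[m]_x rtr (S x *m M).
Proof.
move=> iS.
have ReI i j : m.-integrable setT (EFin \o (fun x => complex.Re (S x i j) * complex.Re (M j i))).
  by apply: eq_integrable (integrableZr measurableT (complex.Re (M j i)) (iS i j).1).
have ImI i j : m.-integrable setT (EFin \o (fun x => complex.Im (S x i j) * complex.Im (M j i))).
  by apply: eq_integrable (integrableZr measurableT (complex.Im (M j i)) (iS i j).2).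
have ijI i j : m.-integrable setT (EFin \o (fun x => complex.Re (S x i j) * complex.Re (M j i)
                - complex.Im (S x i j) * complex.Im (M j i))).
  by apply: eq_integrable (integrableB measurableT (ReI i j) (ImI i j)).
have jI i := Rintegral_sum _ (index_enum 'I_n) _ (ijI i).
have := Rintegral_sum _ (index_enum 'I_n) _ (fun i => (jI i).1).
rewrite (_ : (fun x => \sum_i \sum_j _) = fun x => rtr (S x *m M)); last first.
  by apply/funext => x; rewrite rtr_mulmx.
move=> [iT ->]; split => //.
rewrite rtr_mulmx; apply: eq_bigr => i _; rewrite (jI i).2; apply: eq_bigr => j _.
rewrite RintegralB // !RintegralZr //; [|exact: (iS i j).2|exact: (iS i j).1].
by rewrite !mxE.
Qed.

Lemma rtr_mx_expect S : entries_integrable S ->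
  m.-integrable setT (EFin \o (fun x => rtr (S x))) /\
  rtr (mx_expect m S) = \int[m]_x rtr (S x).
Proof.
move=> /(rtr_mx_expect_mulmx S 1%:M).
by rewrite mulmx1; under [fun x => rtr _]eq_fun do rewrite mulmx1.
Qed.

Lemma Rintegral_rtr S : entries_integrable S ->
  \int[m]_x rtr (S x) = \sum_i \int[m]_x complex.Re (S x i i).
Proof.
move=> iS; rewrite -(rtr_mx_expect S iS).2 /rtr /mxtrace cRe_sum.
by apply: eq_bigr => i _; rewrite mxE.
Qed.

Lemma cvgL1_rtr (h : R -> T -> 'M[R[i]]_n) (l : T -> 'M[R[i]]_n) :
  mx_cvgL1 m h l ->
  \int[m]_x rtr (h t x) @[t --> 0^'+] --> \int[m]_x rtr (l x).
Proof.
move=> L1; have [hint lint _] := L1.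
rewrite (Rintegral_rtr _ (mx_integrable_entries _ lint)).
have : \sum_i (\int[m]_x complex.Re (h t x i i)) @[t --> 0^'+] -->
    \sum_i (\int[m]_x complex.Re (l x i i)).
  apply: cvg_big => [|i _]; first exact: add_continuous.
  exact: cvgL1_Rintegral (mx_cvgL1_entries _ _ _ i i L1).1.
apply: cvg_trans; apply: near_eq_cvg; apply: filterS hint => t ht.
by rewrite (Rintegral_rtr _ (mx_integrable_entries _ ht)).
Qed.

End entries_integrable.

Section frobenius.
Context {R : realType} {n : nat}.
Implicit Types A B : 'M[R[i]]_n.

(** The squared Frobenius norm, which unlike the operator norm is visibly
    measurable and additive over the entries. *)
Definition frob2 A : R :=
  \sum_i \sum_j (complex.Re (A i j) ^+ 2 + complex.Im (A i j) ^+ 2).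

Lemma frob2_ge0 A : 0 <= frob2 A.
Proof. by do 2!(apply: sumr_ge0 => ? _); rewrite addr_ge0 ?sqr_ge0. Qed.

Lemma frob2_opnorm A : frob2 A <= (n%:R * n%:R * 2) * opnorm A ^+ 2.
Proof.
have -> : (n%:R * n%:R * 2) * opnorm A ^+ 2 =
  \sum_(i < n) \sum_(j < n) (opnorm A ^+ 2 + opnorm A ^+ 2).
  rewrite !sumr_const !card_ord -mulrnA -[RHS]mulr_natl natrM; ring.
do 2!(apply: ler_sum => ? _); apply: lerD.
- by rewrite -real_normK ?num_real // lerXn2r ?nnegrE ?opnorm_ge0 // normr_Re_le_opnorm.
- by rewrite -real_normK ?num_real // lerXn2r ?nnegrE ?opnorm_ge0 // normr_Im_le_opnorm.
Qed.

Lemma frob2B A B : frob2 (A - B) <= 2 * frob2 A + 2 * frob2 B.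
Proof.
rewrite /frob2 !mulr_sumr -big_split; apply: ler_sum => i _ /=.
rewrite !mulr_sumr -big_split; apply: ler_sum => j _ /=.
rewrite !mxE cReD cReN cImD cImN.
move: (complex.Re _) (complex.Re _) (complex.Im _) (complex.Im _) => a b c e.
have := sqr_ge0 (a + b); have := sqr_ge0 (c + e); rewrite !sqrrD; nra.
Qed.

(** The bound [2 |x y| <= x^2 + y^2] applied to the products that make up an
    entry of A^2. *)
Lemma normr_sqrmx_le_frob2 A i j :
  `|complex.Re ((A *m A) i j)| <= frob2 A /\ `|complex.Im ((A *m A) i j)| <= frob2 A.
Proof.
have row : \sum_l (complex.Re (A i l) ^+ 2 + complex.Im (A i l) ^+ 2) <= frob2 A.
  rewrite [leRHS](bigD1 i) //= lerDl; do 2!(apply: sumr_ge0 => ? _).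
  by rewrite addr_ge0 ?sqr_ge0.
have col : \sum_l (complex.Re (A l j) ^+ 2 + complex.Im (A l j) ^+ 2) <= frob2 A.
  apply: ler_sum => l _; rewrite (bigD1 j) //= lerDl; apply: sumr_ge0 => ? _.
  by rewrite addr_ge0 ?sqr_ge0.
have key (u : 'I_n -> R) : (forall l, `|u l| <= 
    (complex.Re (A i l) ^+ 2 + complex.Im (A i l) ^+ 2) / 2
    + (complex.Re (A l j) ^+ 2 + complex.Im (A l j) ^+ 2) / 2) ->
    `|\sum_l u l| <= frob2 A.
  move=> hu; apply: le_trans (ler_norm_sum _ _ _) _.
  apply: le_trans (ler_sum _ (fun l _ => hu l)) _.
  rewrite big_split /= -!mulr_suml; lra.
rewrite !mxE cRe_sum cIm_sum; split; apply: key => l; [rewrite cReM|rewrite cImM].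
- move: (complex.Re (A i l)) (complex.Re (A l j))
    (complex.Im (A i l)) (complex.Im (A l j)) => a b c e.
  rewrite ler_norml; apply/andP; split.
  + by have := sqr_ge0 (a + b); have := sqr_ge0 (c - e); rewrite !sqrrD sqrrN; lra.
  + by have := sqr_ge0 (a - b); have := sqr_ge0 (c + e); rewrite !sqrrD sqrrN; lra.
- move: (complex.Re (A i l)) (complex.Re (A l j))
    (complex.Im (A i l)) (complex.Im (A l j)) => a b c e.
  rewrite ler_norml; apply/andP; split.
  + by have := sqr_ge0 (a + e); have := sqr_ge0 (c + b); rewrite !sqrrD; lra.
  + by have := sqr_ge0 (a - e); have := sqr_ge0 (c - b); rewrite !sqrrB; lra.
Qed.

Lemma measurable_frob2 {d} {T : measurableType d} (F : T -> 'M[R[i]]_n) :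
  mx_measurable F -> measurable_fun setT (fun x => frob2 (F x)).
Proof.
move=> mF; apply: measurable_sum => i; apply: measurable_sum => j.
by have [? ?] := mF i j; apply: measurable_funD; exact: measurable_funX.
Qed.
End frobenius.

(** * The process started from its stationary law *)

Section start_law.
Context {R : realType} {d dW : measure_display}.
Context {T : measurableType d} {W : measurableType dW}.
Variables (Pr : R.-pker T ~> W) (Z : R -> W -> T) (mu : probability T R).

Local Notation Pmu := (start_law Pr mu).

(** The law of the process started from mu is a composition of kernels, of
    which Tonelli's theorem is known. *)
Lemma ge0_integral_start_law (f : W -> \bar R) : (forall w, 0 <= f w)%E ->
  measurable_fun setT f ->
  (\int[Pmu]_w f w = \int[mu]_z \int[Pr z]_w f w)%E.
Proof.
move=> f0 mf.
pose l := kprobability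
    (measurable_cst (mu : pprobability T R) : measurable_fun [set: unit] _).
pose k : R.-sfker (unit * T)%type ~> W := kernel.kernel_snd Pr.
transitivity (\int[kcomp l k tt]_w f w)%E.
  by apply: eq_measure_integral.
by rewrite integral_kcomp.
Qed.

Lemma measurable_integral_transition (f : W -> \bar R) : (forall w, 0 <= f w)%E ->
  measurable_fun setT f -> measurable_fun setT (fun z => \int[Pr z]_w f w)%E.
Proof.
move=> f0 mf; apply: measurable_fun_integral_kernel => // U mU.
exact: measurable_kernel.
Qed.

Hypothesis mZ : forall t, 0 <= t -> measurable_fun setT (Z t).

Lemma ge0_integral_stationary (h : T -> \bar R) t : stationary Pr Z mu -> 0 <= t ->
  (forall x, 0 <= h x)%E -> measurable_fun setT h ->
  (\int[Pmu]_w h (Z t w) = \int[mu]_z h z)%E.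
Proof.
move=> st t0 h0 mh.
transitivity (\int[pushforward Pmu (Z t)]_y h y)%E.
  by rewrite ge0_integral_pushforward //; exact: mZ.
apply: eq_measure_integral; first exact: mZ.
by move=> ? A mA _; exact: (st t A t0 mA).
Qed.

(** Exchangeability of (Z_0, Z_t): reversibility gives it on rectangles, which
    determine the joint law. *)
Lemma ge0_integral_reversible (h : T * T -> \bar R) t : 
  stationary Pr Z mu -> reversible Pr Z mu -> 0 <= t ->
  (forall x, 0 <= h x)%E -> measurable_fun setT h ->
  (\int[Pmu]_w h (Z 0 w, Z t w) = \int[Pmu]_w h (Z t w, Z 0 w))%E.
Proof.
move=> st rev t0 h0 mh.
have m0t : measurable_fun setT (fun w => (Z 0 w, Z t w)).
  by apply: measurable_fun_pair; exact: mZ.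
have mt0 : measurable_fun setT (fun w => (Z t w, Z 0 w)).
  by apply: measurable_fun_pair; exact: mZ.
transitivity (\int[pushforward Pmu (fun w => (Z 0 w, Z t w))]_y h y)%E.
  by rewrite ge0_integral_pushforward.
transitivity (\int[pushforward Pmu (fun w => (Z t w, Z 0 w))]_y h y)%E; last first.
  by rewrite ge0_integral_pushforward.
apply: eq_measure_integral => // A mA _.
apply: (@measure_unique _ R _
    [set A1 `*` A2 | A1 in measurable & A2 in measurable] (fun=> setT)).
- exact: measurable_prod_measurableType.
- move=> _ _ [A1 mA1 [A2 mA2 <-]] [B1 mB1 [B2 mB2 <-]].
  rewrite -setXI; exists (A1 `&` B1); first exact: measurableI.
  by exists (A2 `&` B2) => //; exact: measurableI.
- by move=> _; exists setT => //; exists setT => //; rewrite setXTT.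
- by apply/seteqP; split => // x _; exists 0%N.
- move=> _ [A1 mA1 [A2 mA2 <-]].
  have := rev t A1 A2 t0 mA1 mA2; rewrite /pushforward => E.
  by rewrite [LHS]E; congr (Pmu _); apply/seteqP; split=> w [].
- move=> _; have E := st 0 setT (lexx 0) measurableT.
  rewrite -[X in (X < _)%E]/(Pmu (Z 0 @^-1` setT)) E.
  by rewrite probability_setT ltry.
- exact: mA.
Qed.

Lemma ae_initial_state (z : T) : measurable [set z] ->
  (forall z B, measurable B -> Pr z (Z 0 @^-1` B) = \d_z B) ->
  {ae Pr z, forall w, Z 0 w = z}.
Proof.
move=> mz Z0; exists (Z 0 @^-1` (~` [set z])); split.
- rewrite -[X in measurable X]setTI.
  by apply: (mZ 0 (lexx 0)) => //; exact: measurableC.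
- by rewrite Z0 ?diracE ?memNset //; [move=> /(_ erefl)|exact: measurableC].
- by move=> w.
Qed.

End start_law.

Section start_law_Fubini.
Context {R : realType} {d dW : measure_display}.
Context {T : measurableType d} {W : measurableType dW}.
Variables (Pr : R.-pker T ~> W) (mu : probability T R).

Local Notation Pmu := (start_law Pr mu).

(** This is the form in which the conditional expectations exist at a fixed
    time, since regularity only provides, for each z, a range of small times that
    depends on z. *)
Lemma ae_integrable_start_law (u : W -> R) : Pmu.-integrable setT (EFin \o u) ->
  {ae mu, forall z, (Pr z).-integrable setT (EFin \o u)}.
Proof.
move=> /integrableP[mu_ uoo].
have mabs : measurable_fun setT (fun w => `|(u w)%:E|)%E by exact: measurableT_comp.
have : mu.-integrable setT (fun z => \int[Pr z]_w `|(u w)%:E|)%E.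
  apply/integrableP; split; first exact: measurable_integral_transition.
  under eq_integral do rewrite gee0_abs ?integral_ge0 //.
  by rewrite -ge0_integral_start_law.
move=> /(integrable_ae measurableT); apply: filterS => z /(_ Logic.I) hz.
by apply/integrableP; split => //; rewrite ltey_eq hz.
Qed.

Lemma Rintegral_start_law (u : W -> R) : Pmu.-integrable setT (EFin \o u) ->
  mu.-integrable setT (EFin \o (fun z => \int[Pr z]_w u w)) /\
  \int[Pmu]_w u w = \int[mu]_z \int[Pr z]_w u w.
Proof.
move=> iu.
have mu_ := measurable_int _ iu.
have mp := measurable_funepos mu_; have mn := measurable_funeneg mu_.
pose P z := (\int[Pr z]_w ((EFin \o u)^\+ w))%E.
pose N z := (\int[Pr z]_w ((EFin \o u)^\- w))%E.
have mP : measurable_fun setT P by exact: measurable_integral_transition.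
have mN : measurable_fun setT N by exact: measurable_integral_transition.
have P0 z : (0 <= P z)%E by exact: integral_ge0.
have N0 z : (0 <= N z)%E by exact: integral_ge0.
have PE : (\int[mu]_z P z = \int[Pmu]_w ((EFin \o u)^\+ w))%E.
  by rewrite ge0_integral_start_law.
have NE : (\int[mu]_z N z = \int[Pmu]_w ((EFin \o u)^\- w))%E.
  by rewrite ge0_integral_start_law.
have iP : mu.-integrable setT P.
  apply/integrableP; split => //.
  under eq_integral do rewrite gee0_abs //.
  by rewrite PE integral_funepos_lt_pinfty.
have iN : mu.-integrable setT N.
  apply/integrableP; split => //.
  under eq_integral do rewrite gee0_abs //.
  by rewrite NE integral_funeneg_lt_pinfty.
have iPN : mu.-integrable setT (P \- N)%E by exact: integrableB.
have mR : measurable_fun setT (fun z => \int[Pr z]_w u w).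
  have -> : (fun z => \int[Pr z]_w u w) = fine \o (P \- N)%E.
    by apply/funext => z; rewrite /= /Rintegral integralE.
  by apply: measurableT_comp => //; exact: emeasurable_funB.
have ae : ae_eq mu setT (P \- N)%E (EFin \o (fun z => \int[Pr z]_w u w)).
  apply: filterS (integrable_ae measurableT iPN) => z h zT.
  rewrite -[LHS]fineK; last exact: h.
  by rewrite /= /Rintegral integralE.
have iR : mu.-integrable setT (EFin \o (fun z => \int[Pr z]_w u w)).
  apply: le_integrable iPN => //; first exact/measurable_EFinP.
  move=> z _; rewrite /= /Rintegral integralE -/(P z) -/(N z).
  by case: (P z - N z)%E => [r| |]; rewrite /= ?normr0 ?leey.
split => //.
rewrite /Rintegral; congr fine.
transitivity (\int[mu]_z ((P \- N)%E z))%E.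
  by rewrite integralB // PE NE -integralE.
by apply: ae_eq_integral ae => //; [exact: emeasurable_funB|exact/measurable_EFinP].
Qed.
End start_law_Fubini.

(** * The Dirichlet form as an integral of the carré du champ *)

Section dirichlet.
Local Open Scope complex_scope.
Context {R : realType} {d dW : measure_display}.
Context {T : measurableType d} {W : measurableType dW}.
Variables (Pr : R.-pker T ~> W) (Z : R -> W -> T) (mu : probability T R).
Local Notation Pmu := (start_law Pr mu).
Hypothesis mZ : forall t, 0 <= t -> measurable_fun setT (Z t).
Hypothesis st : stationary Pr Z mu.
Context {n : nat}.
Implicit Types F : T -> 'M[R[i]]_n.

Lemma mx_measurable_comp F (g : W -> T) : mx_measurable F ->
  measurable_fun setT g -> mx_measurable (F \o g).
Proof.
move=> mF mg i j; have [mF1 mF2] := mF i j.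
by split; [exact: (measurableT_comp mF1 mg)|exact: (measurableT_comp mF2 mg)].
Qed.

Lemma mx_measurable_sq_increment F t : mx_measurable F -> 0 <= t ->
  mx_measurable (sq_increment Z F t).
Proof.
move=> mF t0.
have m1 := mx_measurable_comp F _ mF (mZ t t0).
have m2 := mx_measurable_comp F _ mF (mZ 0 (lexx 0)).
by apply: mx_measurableM; apply: mx_measurableB.
Qed.

(** The function is divided by the constant of [frob2_opnorm], instead of
    multiplying the squared operator norm by it: the integral of a function not
    known to be measurable need not be linear. *)
Lemma integrable_frob2 F : mx_measurable F ->
  (\int[mu]_z (opnorm (F z) ^+ 2)%:E < +oo)%E ->
  mu.-integrable setT (EFin \o (fun z => frob2 (F z))).
Proof.
move=> mF Foo.
(* The summand 1 keeps K invertible when n = 0. *)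
pose K : R := n%:R * n%:R * 2 + 1.
have K0 : 0 < K by rewrite ltr_wpDl // !mulr_ge0.
have : mu.-integrable setT (EFin \o (fun z => K^-1 * frob2 (F z))).
  apply: integrable_le_nonmeasurable Foo.
    by apply: measurable_funM => //; exact: measurable_frob2.
  move=> z; rewrite ger0_norm ?mulr_ge0 ?invr_ge0 ?(ltW K0) ?frob2_ge0 //.
  rewrite ler_pdivrMl //; apply: le_trans (frob2_opnorm _) _.
  by rewrite ler_wpM2r ?sqr_ge0 // lerDl.
move=> /(integrableZl measurableT K); apply: eq_integrable => // z _ /=.
by rewrite -EFinM mulrA mulfV ?mul1r // gt_eqF.
Qed.

Lemma integrable_stationary (h : T -> R) t : 0 <= t ->
  mu.-integrable setT (EFin \o h) -> Pmu.-integrable setT (EFin \o (fun w => h (Z t w))).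
Proof.
move=> t0 /integrableP[mh hoo]; apply/integrableP; split.
  exact: (measurableT_comp mh (mZ t t0)).
rewrite (ge0_integral_stationary Pr Z mu mZ (fun z => `|(h z)%:E|%E)) //.
exact: measurableT_comp.
Qed.

Lemma entries_integrable_sq_increment F t : mx_measurable F ->
  (\int[mu]_z (opnorm (F z) ^+ 2)%:E < +oo)%E -> 0 <= t ->
  entries_integrable Pmu (sq_increment Z F t).
Proof.
move=> mF Foo t0.
have fI := integrable_frob2 F mF Foo.
have fI2 s : 0 <= s -> Pmu.-integrable setT (EFin \o (fun w => 2 * frob2 (F (Z s w)))).
  move=> s0; have := integrableZl measurableT 2 (integrable_stationary _ s s0 fI).
  exact: eq_integrable.
have dI : Pmu.-integrable setT
    (EFin \o (fun w => 2 * frob2 (F (Z t w)) + 2 * frob2 (F (Z 0 w)))).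
  by apply: eq_integrable (integrableD measurableT (fI2 t t0) (fI2 0 (lexx 0))).
have mS := mx_measurable_sq_increment F t mF t0.
have S0 w : 0 <= 2 * frob2 (F (Z t w)) + 2 * frob2 (F (Z 0 w)).
  by rewrite addr_ge0 // mulr_ge0 // frob2_ge0.
move=> i j; split.
- apply: le_integrable dI => //; first by apply/measurable_EFinP; have [] := mS i j.
  move=> w _ /=; rewrite lee_fin [leRHS]ger0_norm //.
  exact: le_trans (normr_sqrmx_le_frob2 _ i j).1 (frob2B _ _).
- apply: le_integrable dI => //; first by apply/measurable_EFinP; have [] := mS i j.
  move=> w _ /=; rewrite lee_fin [leRHS]ger0_norm //.
  exact: le_trans (normr_sqrmx_le_frob2 _ i j).2 (frob2B _ _).
Qed.

(** Fubini over the starting point: the expectation that defines the Dirichlet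
    form is, at each time, the mean over mu of the one that defines the carré du
    champ. *)
Lemma mx_expect_start_law F t : mx_measurable F ->
  (\int[mu]_z (opnorm (F z) ^+ 2)%:E < +oo)%E -> 0 <= t ->
  ((2 * t)^-1)%:C *: mx_expect Pmu (sq_increment Z F t) =
  mx_expect mu (carre_approx Pr Z F t).
Proof.
move=> mF Foo t0; have iS := entries_integrable_sq_increment F t mF Foo t0.
apply/matrixP => i j; rewrite mxE [RHS]mxE.
have [iRe ReE] := Rintegral_start_law Pr mu _ (iS i j).1.
have [iIm ImE] := Rintegral_start_law Pr mu _ (iS i j).2.
apply/eqP; rewrite eq_complex; apply/andP; split; apply/eqP.
- rewrite cReZ mxE /= ReE -RintegralZl //; apply: eq_Rintegral => z _.
  by rewrite mxE cReZ mxE.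
- rewrite cImZ mxE /= ImE -RintegralZl //; apply: eq_Rintegral => z _.
  by rewrite mxE cImZ mxE.
Qed.

(** The L_1 convergence of the approximations allows the limit to be taken under
    the integral over mu. *)
Lemma dirichlet_carre F : regular Pr Z mu F ->
  dirichlet Pr Z mu F = mx_expect mu (carre_du_champ Pr Z F).
Proof.
move=> [hF mF Foo _ L1].
have nearE : \forall t \near 0^'+,
    mx_expect mu (carre_approx Pr Z F t) =
    ((2 * t)^-1)%:C *: mx_expect Pmu (sq_increment Z F t).
  by near=> t; rewrite mx_expect_start_law.
apply: lim_cmx => i j.
- have [/cvgL1_Rintegral c _] := mx_cvgL1_entries mu _ _ i j L1.
  rewrite [X in _ --> complex.Re X]mxE /=.
  apply: cvg_trans c; apply: near_eq_cvg.
  by apply: filterS nearE => t <-; rewrite [in RHS]mxE.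
- have [_ /cvgL1_Rintegral c] := mx_cvgL1_entries mu _ _ i j L1.
  rewrite [X in _ --> complex.Im X]mxE /=.
  apply: cvg_trans c; apply: near_eq_cvg.
  by apply: filterS nearE => t <-; rewrite [in RHS]mxE.
Unshelve. all: by end_near. Qed.
End dirichlet.

(** * The chain rule inequality in one variable *)

Section derivative_measurable.
Context {R : realType}.

(** A derivative is a pointwise limit of difference quotients along the
    sequence 1 / (m + 1). *)
Lemma measurable_derive1 (phi : R -> R) : (forall x : R, derivable phi x 1) ->
  measurable_fun [set: R] (derive1 phi).
Proof.
move=> dphi.
have mphi : measurable_fun [set: R] phi.
  apply: continuous_measurable_fun => x.
  by apply: differentiable_continuous; apply/derivable1_diffP.
pose g x (h : R) : R := h^-1 * (phi (h + x) - phi x).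
refine (@measurable_fun_cvg _ _ R [set: R] (fun m x => g x (harmonic m))
  (derive1 phi) _ _) => [m|x _].
  apply: measurable_funM => //; apply: measurable_funB => //.
  by apply: measurableT_comp => //; exact: measurable_funD.
have h0 : (harmonic : R^nat) @ \oo --> (0 : R)^'.
  move=> A hA; have hA' := cvg_harmonic hA.
  suff : \forall m \near \oo, A (harmonic m) by [].
  have : \forall m \near \oo, (harmonic m : R) != 0 -> A (harmonic m) by exact: hA'.
  by apply: filterS => m; apply; rewrite lt0r_neq0 // harmonic_gt0.
have gE : (fun h : R => h^-1 *: ((phi \o shift x) (h *: (1 : R)) - phi x)) = g x.
  by apply/funext => h; rewrite /g /= /GRing.scale /= mulr1.
have cg : cvg (g x @ (0 : R)^') by rewrite -gE; exact: (dphi x).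
exact: cvg_comp h0 cg.
Qed.
End derivative_measurable.

Lemma ge0_integrable_EFin {R : realType} d (T : measurableType d)
    (m : {measure set T -> \bar R}) (g : T -> R) (r : R) :
  (forall x, 0 <= g x) -> measurable_fun setT (fun x => (g x)%:E) ->
  (\int[m]_x (g x)%:E = r%:E)%E -> m.-integrable setT (fun x => (g x)%:E).
Proof.
move=> g0 mg gE; apply/integrableP; split => //.
by under eq_integral do rewrite gee0_abs ?lee_fin //; rewrite gE ltry.
Qed.

Section univariate.
Context {R : realType} {d dW : measure_display}.
Context {T : measurableType d} {W : measurableType dW}.
Variables (Pr : R.-pker T ~> W) (Z : R -> W -> T) (mu : probability T R).
Local Notation Pmu := (start_law Pr mu).
Hypothesis mZ : forall t, 0 <= t -> measurable_fun setT (Z t).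
Hypothesis Z0 : forall z B, measurable B -> Pr z (Z 0 @^-1` B) = \d_z B.
Hypothesis st : stationary Pr Z mu.
Hypothesis rev : reversible Pr Z mu.
Hypothesis mset1 : forall z : T, measurable [set z].
Variables phi psi : R -> R.
Hypothesis dphi : forall x : R, derivable phi x 1.
Hypothesis psiE : forall x, (derive1 phi x) ^+ 2 = psi x.
Hypothesis cpsi : convex_function (setT : set R^o) psi.
Context {n : nat}.
Variable f : T -> 'M[R[i]]_n.
Hypothesis hf : forall z, f z \is hermsymmx.
Hypothesis mf : mx_measurable f.
Hypothesis foo : (\int[mu]_z (opnorm (f z) ^+ 2)%:E < +oo)%E.

Let psi0 x : 0 <= psi x. Proof. by rewrite -psiE sqr_ge0. Qed.

Let mpsif : mx_measurable (fun z => mxfun psi (f z)).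
Proof.
apply: measurable_mxfun => //.
have -> : psi = fun x => derive1 phi x ^+ 2 by apply/funext => x; rewrite psiE.
by apply: measurable_funX; exact: measurable_derive1.
Qed.

(** The increment from p.1 to p.2 weighted by psi at its origin; exchanging Z_0
   and Z_t moves the weight to the end point. *)
Let G (p : T * T) : R :=
  rtr ((f p.2 - f p.1) *m (f p.2 - f p.1) *m mxfun psi (f p.1)).

Let G_ge0 p : 0 <= G p.
Proof. by rewrite /G sqrmxB_sym rtr_sqrB_mxfun_ge0. Qed.

Let mG : measurable_fun setT G.
Proof.
have mf1 := mx_measurable_comp f _ mf (@measurable_fst _ _ T T).
have mf2 := mx_measurable_comp f _ mf (@measurable_snd _ _ T T).
have mp1 := mx_measurable_comp _ _ mpsif (@measurable_fst _ _ T T).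
by apply/measurable_rtr/mx_measurableM => //; apply: mx_measurableM;
    apply: mx_measurableB.
Qed.

Let mG_process s t : 0 <= s -> 0 <= t ->
  measurable_fun setT (fun w => (G (Z s w, Z t w))%:E).
Proof.
move=> s0 t0; apply/measurable_EFinP.
by apply: (measurableT_comp mG); apply: measurable_fun_pair; exact: mZ.
Qed.

(* Given Z_0 = z the weight is the constant matrix psi(f z), which comes out of
   the conditional expectation by linearity. *)
Let integral_G t : 0 < t ->
  mu.-integrable setT
    (EFin \o (fun z => rtr (carre_approx Pr Z f t z *m mxfun psi (f z)))) ->
  (\int[Pmu]_w (G (Z 0%R w, Z t w))%:E =
   (2 * t * \int[mu]_z rtr (carre_approx Pr Z f t z *m mxfun psi (f z)))%:E)%E.
Proof.
move=> t0 iH; have t0' := ltW t0.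
have iS := entries_integrable_sq_increment Pr Z mu mZ st f t mf foo t0'.
have ae_entries : {ae mu, forall z, entries_integrable (Pr z) (sq_increment Z f t)}.
  suff : \forall z \near almost_everywhere mu,
     forall i j,
    (Pr z).-integrable setT (EFin \o fun x => complex.Re (sq_increment Z f t x i j)) /\
      (Pr z).-integrable setT (EFin \o fun x => complex.Im (sq_increment Z f t x i j)) by [].
  apply: filter_forall => i; apply: filter_forall => j.
  have [iRe iIm] := iS i j.
  exact: filterI (ae_integrable_start_law Pr mu _ iRe)
    (ae_integrable_start_law Pr mu _ iIm).
have mGt := mG_process 0 t (lexx 0) t0'.
have G0 w : (0 <= (G (Z 0%R w, Z t w))%:E)%E by rewrite lee_fin.
rewrite (ge0_integral_start_law Pr mu _ G0 mGt).
have iH2 := integrableZl measurableT (2 * t) iH.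
transitivity
    (\int[mu]_z (2 * t * rtr (carre_approx Pr Z f t z *m mxfun psi (f z)))%:E)%E; last first.
  rewrite -RintegralZl // /Rintegral fineK //.
  exact: (integrable_fin_num measurableT iH2).
apply: ae_eq_integral => //.
- exact: measurable_integral_transition.
- exact: measurable_int iH2.
apply: filterS ae_entries => z iSz _.
have [iR RE] := rtr_mx_expect_mulmx _ _ (mxfun psi (f z)) iSz.
transitivity (\int[Pr z]_w (rtr (sq_increment Z f t w *m mxfun psi (f z)))%:E)%E.
  apply: ae_eq_integral; [exact: measurableT|exact: mGt|exact: measurable_int iR|].
  apply: filterS (ae_initial_state Pr Z mZ z (mset1 z) Z0) => w Z0w _.
  rewrite /G /fst /snd -/(sq_increment Z f t w).
  by rewrite Z0w.
have -> : 2 * t * rtr (carre_approx Pr Z f t z *m mxfun psi (f z)) =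
  \int[Pr z]_w rtr (sq_increment Z f t w *m mxfun psi (f z)).
  rewrite -RE /carre_approx -scalemxAl rtrZ mulrA mulfV ?mul1r //.
  by rewrite mulf_neq0 // gt_eqF.
by rewrite /Rintegral fineK //; exact: (integrable_fin_num measurableT iR).
Qed.

Hypothesis mphif : mx_measurable (mxfun phi \o f).
Hypothesis phifoo : (\int[mu]_z (opnorm (mxfun phi (f z)) ^+ 2)%:E < +oo)%E.

(** The inequality at a fixed time: the trace inequality is integrated along the
    stationary process, where the two weighted terms have the same expectation. *)
Lemma carre_approx_le t : 0 < t ->
  mx_integrable mu (carre_approx Pr Z (mxfun phi \o f) t) ->
  mu.-integrable setT
    (EFin \o (fun z => rtr (carre_approx Pr Z f t z *m mxfun psi (f z)))) ->
  \int[mu]_z rtr (carre_approx Pr Z (mxfun phi \o f) t z) <=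
  \int[mu]_z rtr (carre_approx Pr Z f t z *m mxfun psi (f z)).
Proof.
move=> t0 iA iH; have t0' := ltW t0.
have iS := entries_integrable_sq_increment Pr Z mu mZ st _ t mphif phifoo t0'.
have [iu uE] := rtr_mx_expect _ _ iS.
rewrite -(rtr_mx_expect _ _ (mx_integrable_entries _ _ iA)).2.
rewrite -(mx_expect_start_law Pr Z mu mZ st _ t mphif phifoo t0') rtrZ uE.
rewrite ler_pdivrMl ?mulr_gt0 //.
set I := \int[mu]_z _.
have X : (\int[Pmu]_w (G (Z 0%R w, Z t w))%:E = (2 * t * I)%:E)%E.
  exact: integral_G.
have Y : (\int[Pmu]_w (G (Z t w, Z 0%R w))%:E = (2 * t * I)%:E)%E.
  rewrite -X [RHS](ge0_integral_reversible Pr Z mu mZ (EFin \o G)) //.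
  exact/measurable_EFinP.
have mGt := mG_process 0 t (lexx 0) t0'.
have mGt' := mG_process t 0 t0' (lexx 0).
suff : (\int[Pmu]_w (2 * rtr (sq_increment Z (mxfun phi \o f) t w))%:E <=
        (2 * t * I)%:E + (2 * t * I)%:E)%E.
  have -> : (\int[Pmu]_w (2 * rtr (sq_increment Z (mxfun phi \o f) t w))%:E =
     (2 * \int[Pmu]_w rtr (sq_increment Z (mxfun phi \o f) t w))%:E)%E.
    rewrite -RintegralZl // /Rintegral fineK //.
    exact: (integrable_fin_num measurableT (integrableZl measurableT 2 iu)).
  by rewrite -EFinD lee_fin; lra.
have int0t := ge0_integrable_EFin _ _ Pmu (fun w => G (Z 0 w, Z t w)) _
    (fun w => G_ge0 _) mGt X.
have intt0 := ge0_integrable_EFin _ _ Pmu (fun w => G (Z t w, Z 0 w)) _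
    (fun w => G_ge0 _) mGt' Y.
rewrite [leRHS](_ : _ =
    \int[Pmu]_w ((G (Z 0%R w, Z t w))%:E + (G (Z t w, Z 0%R w))%:E))%E; last first.
  by rewrite (integralD measurableT int0t intt0); exact: esym (congr2 adde X Y).
apply: le_integral.
- exact: measurableT.
- exact: (integrableZl measurableT 2 iu).
- exact: (integrableD measurableT int0t intt0).
move=> w _; rewrite -EFinD lee_fin.
have half (u a b : R) : u <= (a + b) / 2 -> 2 * u <= b + a by lra.
rewrite /G /fst /snd (sqrmxB_sym (f (Z 0 w)) (f (Z t w))) /sq_increment /comp.
apply: half.
exact: (mean_value_trace_inequality phi psi (f (Z t w)) (f (Z 0 w))
  dphi psiE cpsi (hf _) (hf _)).
Qed.

End univariate.

Section univariate_chain_rule.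
Context {R : realType} {d dW : measure_display}.
Context {T : measurableType d} {W : measurableType dW}.
Variables (Pr : R.-pker T ~> W) (Z : R -> W -> T) (mu : probability T R).
Hypothesis mZ : forall t, 0 <= t -> measurable_fun setT (Z t).
Hypothesis Z0 : forall z B, measurable B -> Pr z (Z 0 @^-1` B) = \d_z B.
Hypothesis st : stationary Pr Z mu.
Hypothesis rev : reversible Pr Z mu.
Hypothesis mset1 : forall z : T, measurable [set z].
Variables phi psi : R -> R.
Hypothesis dphi : forall x : R, derivable phi x 1.
Hypothesis psiE : forall x, (derive1 phi x) ^+ 2 = psi x.
Hypothesis cpsi : convex_function (setT : set R^o) psi.

Lemma rtr_dirichlet n (f : T -> 'M[R[i]]_n) : regular Pr Z mu f ->
  rtr (dirichlet Pr Z mu f) = \int[mu]_z rtr (carre_du_champ Pr Z f z).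
Proof.
move=> rf; rewrite (dirichlet_carre Pr Z mu mZ st f rf).
have [_ _ _ _ [_ iG _]] := rf.
exact: (rtr_mx_expect _ _ (mx_integrable_entries _ _ iG)).2.
Qed.

(** Both sides of [carre_approx_le] converge as t decreases to 0. *)
Lemma carre_du_champ_chain_le n (f : T -> 'M[R[i]]_n) : suitable Pr Z mu phi psi f ->
  \int[mu]_z rtr (carre_du_champ Pr Z (mxfun phi \o f) z) <=
  \int[mu]_z rtr (carre_du_champ Pr Z f z *m mxfun psi (f z)).
Proof.
move=> [[hf mf foo _ _] [_ mphif phifoo _ L1] c].
have [iA _ _] := L1; have [iH _ _] := c.
apply: (ler_cvg_to (cvgL1_rtr _ _ _ L1) (cvgL1_Rintegral _ _ _ c)).
near=> t; apply: (carre_approx_le Pr Z mu mZ Z0 st rev mset1 phi psi dphi psiE cpsi f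
  hf mf foo mphif phifoo) => //.
- by near: t; exact: iA.
- by near: t; exact: iH.
Unshelve. all: by end_near. Qed.

End univariate_chain_rule.

(** * The chain rule inequality in two variables *)

Lemma integral_cst_probability {R : realType} d (T : measurableType d)
    (P : probability T R) (c : \bar R) : (\int[P]_x c = c)%E.
Proof.
apply: etrans (integral_cst P measurableT c) _.
by rewrite [X in (c * X)%E](probability_setT P) mule1.
Qed.

Section partial_integrals.
Context {R : realType} {d1 d2 : measure_display}.
Context {T1 : measurableType d1} {T2 : measurableType d2}.
Variables (P1 : probability T1 R) (P2 : probability T2 R).
Variable u : T1 * T2 -> R.
Hypothesis iu : (P1 \x P2)%E.-integrable setT (EFin \o u).

Let fine_abs_le (x : \bar R) : (`|(fine x)%:E| <= `|x|)%E.
Proof. by case: x => [r| |] //=; rewrite normr0 leey. Qed.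

(** Fubini in the form needed for slices: the partial integral is kept as a
    function on the product, where it can be compared with the integrand. *)
Lemma Rintegral_partial1 :
  (P1 \x P2)%E.-integrable setT (EFin \o (fun z => \int[P1]_x u (x, z.2))) /\
  \int[(P1 \x P2)%E]_z (\int[P1]_x u (x, z.2)) = \int[(P1 \x P2)%E]_z u z.
Proof.
have mu_ := measurable_int _ iu.
pose G (y : T2) := (\int[P1]_x (u (x, y))%:E)%E.
pose v (y : T2) : R := \int[P1]_x u (x, y).
have mG : measurable_fun setT G by exact: (measurable_fubini_G iu).
have mv : measurable_fun setT v by exact: measurableT_comp mG.
have mv2 : measurable_fun setT (fun z : T1 * T2 => (v z.2)%:E).
  by apply/measurable_EFinP; exact: (measurableT_comp mv measurable_snd).
have absu : (\int[P2]_y \int[P1]_x `|(u (x, y))%:E| < +oo)%E.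
  exact: ((@integrable21ltyP _ _ T1 T2 R P1 P2 (EFin \o u) mu_).1 iu).
have iv : (P1 \x P2)%E.-integrable setT (fun z : T1 * T2 => (v z.2)%:E).
  apply: (@integrable21ltyP _ _ T1 T2 R P1 P2 _ mv2).2; apply: le_lt_trans absu.
  apply: ge0_le_integral_nonmeasurable => y; first exact: integral_ge0.
  rewrite [leLHS](integral_cst_probability _ _ P1 `|(v y)%:E|%E).
  apply: le_trans (fine_abs_le _) _; apply: le_abse_integral => //.
  exact: (measurableT_comp mu_ (pair2_measurable y)).
split; first exact: iv.
rewrite /Rintegral; congr fine.
rewrite -(integral21_prod_meas1 iu) -(integral21_prod_meas1 iv).
apply: ae_eq_integral => //.
- exact: (measurable_fubini_G iv).
- apply: filterS (ae_integrable2 iu) => y iy _.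
  have -> : fubini_G P1 (fun z : T1 * T2 => (v z.2)%:E) y = (v y)%:E.
    by rewrite /fubini_G; exact: (integral_cst_probability _ _ P1 (v y)%:E).
  rewrite /v /Rintegral fineK //.
  exact: (integrable_fin_num measurableT iy).
Qed.

Lemma Rintegral_partial2 :
  (P1 \x P2)%E.-integrable setT (EFin \o (fun z => \int[P2]_y u (z.1, y))) /\
  \int[(P1 \x P2)%E]_z (\int[P2]_y u (z.1, y)) = \int[(P1 \x P2)%E]_z u z.
Proof.
have mu_ := measurable_int _ iu.
pose F (x : T1) := (\int[P2]_y (u (x, y))%:E)%E.
pose v (x : T1) : R := \int[P2]_y u (x, y).
have mF : measurable_fun setT F by exact: (measurable_fubini_F iu).
have mv : measurable_fun setT v by exact: measurableT_comp mF.
have mv2 : measurable_fun setT (fun z : T1 * T2 => (v z.1)%:E).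
  by apply/measurable_EFinP; exact: (measurableT_comp mv measurable_fst).
have absu : (\int[P1]_x \int[P2]_y `|(u (x, y))%:E| < +oo)%E.
  exact: ((@integrable12ltyP _ _ T1 T2 R P1 P2 (EFin \o u) mu_).1 iu).
have iv : (P1 \x P2)%E.-integrable setT (fun z : T1 * T2 => (v z.1)%:E).
  apply: (@integrable12ltyP _ _ T1 T2 R P1 P2 _ mv2).2; apply: le_lt_trans absu.
  apply: ge0_le_integral_nonmeasurable => x; first exact: integral_ge0.
  rewrite [leLHS](integral_cst_probability _ _ P2 `|(v x)%:E|%E).
  apply: le_trans (fine_abs_le _) _; apply: le_abse_integral => //.
  exact: (measurableT_comp mu_ (pair1_measurable x)).
split; first exact: iv.
rewrite /Rintegral; congr fine.
rewrite -(integral12_prod_meas1 iu) -(integral12_prod_meas1 iv).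
apply: ae_eq_integral => //.
- exact: (measurable_fubini_F iv).
- apply: filterS (ae_integrable1 iu) => x ix _.
  have -> : fubini_F P2 (fun z : T1 * T2 => (v z.1)%:E) x = (v x)%:E.
    by rewrite /fubini_F; exact: (integral_cst_probability _ _ P2 (v x)%:E).
  rewrite /v /Rintegral fineK //.
  exact: (integrable_fin_num measurableT ix).
Qed.

End partial_integrals.

Section bivariate_chain_rule.
Context {R : realType} {d dW : measure_display}.
Context {T : measurableType d} {W : measurableType dW}.
Variables (Pr : R.-pker T ~> W) (Z : R -> W -> T) (mu : probability T R).
Hypothesis mZ : forall t, 0 <= t -> measurable_fun setT (Z t).
Hypothesis st : stationary Pr Z mu.
Local Notation mu2 := (mu \x mu)%E.

(** On each slice the Dirichlet form is the integral of the carré du champ; what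
    remains is to integrate a partial integral over the product. *)
Lemma rtr_biv_dirichlet n (g : T * T -> 'M[R[i]]_n) : biv_regular Pr Z mu g ->
  rtr (biv_dirichlet Pr Z mu g) = \int[mu2]_z rtr (biv_carre_du_champ Pr Z g z).
Proof.
move=> [_ _ _ [reg1 reg2] [[_ iG1 _] [_ iG2 _]]].
pose D1 (z : T * T) := dirichlet1 Pr Z mu g z.2;
    pose D2 (z : T * T) := dirichlet2 Pr Z mu g z.1.
have {}iG1 := mx_integrable_entries _ _ iG1.
have {}iG2 := mx_integrable_entries _ _ iG2.
have D1E z : D1 z = mx_expect mu (fun x => carre_du_champ1 Pr Z g (x, z.2)).
  exact: (dirichlet_carre Pr Z mu mZ st _ (reg1 z.2)).
have D2E z : D2 z = mx_expect mu (fun y => carre_du_champ2 Pr Z g (z.1, y)).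
  exact: (dirichlet_carre Pr Z mu mZ st _ (reg2 z.1)).
have DE : biv_dirichlet Pr Z mu g = mx_expect mu2 (fun z => D1 z + D2 z) by [].
clearbody D1 D2; rewrite DE.
have ReD1 i j := Rintegral_partial1 mu mu _ (iG1 i j).1.
have ImD1 i j := Rintegral_partial1 mu mu _ (iG1 i j).2.
have ReD2 i j := Rintegral_partial2 mu mu _ (iG2 i j).1.
have ImD2 i j := Rintegral_partial2 mu mu _ (iG2 i j).2.
have ReE i j : (fun z => complex.Re ((D1 z + D2 z) i j)) = fun z =>
    \int[mu]_x complex.Re (carre_du_champ1 Pr Z g (x, z.2) i j)
    + \int[mu]_y complex.Re (carre_du_champ2 Pr Z g (z.1, y) i j).
  apply/funext => z; rewrite mxE cReD D1E D2E.
  by congr (_ + _); rewrite mxE.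
have ImE i j : (fun z => complex.Im ((D1 z + D2 z) i j)) = fun z =>
    \int[mu]_x complex.Im (carre_du_champ1 Pr Z g (x, z.2) i j)
    + \int[mu]_y complex.Im (carre_du_champ2 Pr Z g (z.1, y) i j).
  apply/funext => z; rewrite mxE cImD D1E D2E.
  by congr (_ + _); rewrite mxE.
have iD : entries_integrable mu2 (fun z => D1 z + D2 z).
  move=> i j; rewrite ReE ImE; split.
  - by apply: eq_integrable (integrableD measurableT (ReD1 i j).1 (ReD2 i j).1).
  - by apply: eq_integrable (integrableD measurableT (ImD1 i j).1 (ImD2 i j).1).
have iG : entries_integrable mu2 (biv_carre_du_champ Pr Z g).
  move=> i j; split.
  - apply: eq_integrable (integrableD measurableT (iG1 i j).1 (iG2 i j).1) => // z _.
    by rewrite /biv_carre_du_champ /= mxE cReD.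
  - apply: eq_integrable (integrableD measurableT (iG1 i j).2 (iG2 i j).2) => // z _.
    by rewrite /biv_carre_du_champ /= mxE cImD.
rewrite (rtr_mx_expect _ _ iD).2.
rewrite (Rintegral_rtr _ _ iD) (Rintegral_rtr _ _ iG); apply: eq_bigr => i _.
rewrite (ReE i i) (RintegralD measurableT (ReD1 i i).1 (ReD2 i i).1).
apply: etrans (congr2 +%R (ReD1 i i).2 (ReD2 i i).2) _.
apply: etrans (esym (RintegralD measurableT (iG1 i i).1 (iG2 i i).1)) _.
by apply: eq_Rintegral => z _; rewrite /biv_carre_du_champ mxE cReD.
Qed.

Hypothesis Z0 : forall z B, measurable B -> Pr z (Z 0 @^-1` B) = \d_z B.
Hypothesis rev : reversible Pr Z mu.
Hypothesis mset1 : forall z : T, measurable [set z].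
Variables phi psi : R -> R.
Hypothesis dphi : forall x : R, derivable phi x 1.
Hypothesis psiE : forall x, (derive1 phi x) ^+ 2 = psi x.
Hypothesis cpsi : convex_function (setT : set R^o) psi.

Lemma le_Rintegral_partial1 (u v : T * T -> R) :
  mu2.-integrable setT (EFin \o u) -> mu2.-integrable setT (EFin \o v) ->
  (forall y, \int[mu]_x u (x, y) <= \int[mu]_x v (x, y)) ->
  \int[mu2]_z u z <= \int[mu2]_z v z.
Proof.
move=> iu iv uv.
have [iu' <-] := Rintegral_partial1 mu mu _ iu.
have [iv' <-] := Rintegral_partial1 mu mu _ iv.
by apply: le_Rintegral => // z _; exact: uv.
Qed.

Lemma le_Rintegral_partial2 (u v : T * T -> R) :
  mu2.-integrable setT (EFin \o u) -> mu2.-integrable setT (EFin \o v) ->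
  (forall x, \int[mu]_y u (x, y) <= \int[mu]_y v (x, y)) ->
  \int[mu2]_z u z <= \int[mu2]_z v z.
Proof.
move=> iu iv uv.
have [iu' <-] := Rintegral_partial2 mu mu _ iu.
have [iv' <-] := Rintegral_partial2 mu mu _ iv.
by apply: le_Rintegral => // z _; exact: uv.
Qed.

(** Each of the two partial carrés du champ is treated separately, slice by
    slice. *)
Lemma biv_carre_du_champ_chain_le n (g : T * T -> 'M[R[i]]_n) :
  biv_suitable Pr Z mu phi psi g ->
  \int[mu2]_z rtr (biv_carre_du_champ Pr Z (mxfun phi \o g) z) <=
  \int[mu2]_z rtr (biv_carre_du_champ Pr Z g z *m mxfun psi (g z)).
Proof.
move=> [[_ _ _ [reg1 reg2] _] [_ _ _ [preg1 preg2] [[_ iG1 _] [_ iG2 _]]] c1 c2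
  [[_ iH1 _] [_ iH2 _]]].
have {}iG1 := (rtr_mx_expect _ _ (mx_integrable_entries _ _ iG1)).1.
have {}iG2 := (rtr_mx_expect _ _ (mx_integrable_entries _ _ iG2)).1.
have chain f sf := carre_du_champ_chain_le Pr Z mu mZ Z0 st rev mset1
  phi psi dphi psiE cpsi n f sf.
have -> : (\int[mu2]_z rtr (biv_carre_du_champ Pr Z (mxfun phi \o g) z)) =
   \int[mu2]_z rtr (carre_du_champ1 Pr Z (mxfun phi \o g) z)
   + \int[mu2]_z rtr (carre_du_champ2 Pr Z (mxfun phi \o g) z).
  rewrite -(RintegralD measurableT iG1 iG2).
  by apply: eq_Rintegral => z _; exact: rtrD.
have -> : (\int[mu2]_z rtr (biv_carre_du_champ Pr Z g z *m mxfun psi (g z))) =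
   \int[mu2]_z rtr (carre_du_champ1 Pr Z g z *m mxfun psi (g z))
   + \int[mu2]_z rtr (carre_du_champ2 Pr Z g z *m mxfun psi (g z)).
  rewrite -(RintegralD measurableT iH1 iH2).
  apply: eq_Rintegral => z _; rewrite /biv_carre_du_champ mulmxDl; exact: rtrD.
apply: lerD.
- apply: (le_Rintegral_partial1 _ _ iG1 iH1) => y.
  exact: (chain (slice1 g y) (And3 (reg1 y) (preg1 y) (c1 y))).
- apply: (le_Rintegral_partial2 _ _ iG2 iH2) => x.
  exact: (chain (slice2 g x) (And3 (reg2 x) (preg2 x) (c2 x))).
Qed.

End bivariate_chain_rule.

(** * Polish state spaces *)

(** Points are closed in a metric space. *)
Lemma polish_measurable_set1 (R : realType) (Omega : ptopologicalType) (z : borel Omega) :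
  polish R Omega -> measurable [set z].
Proof.
move=> [_ [dist [dist0 _ _ nbhs_dist _]]].
rewrite -[X in measurable X]setCK; apply: measurableC; apply: sub_sigma_algebra.
rewrite openE => y /= yz; rewrite /interior nbhs_dist; exists (dist y z).
  have [d0 dE] := dist0 y z; rewrite lt_neqAle d0 andbT eq_sym.
  by apply/negP => /eqP /dE.
by move=> w /= yw wz; move: yw; rewrite wz ltxx.
Qed.

Theorem proposition5p1 (R : realType) (Omega : ptopologicalType)
    (dW : measure_display) (W : measurableType dW)
    (Pr : R.-pker (borel Omega) ~> W) (Z : R -> W -> borel Omega)
    (mu : probability (borel Omega) R) (alpha : R) (phi : R -> R) :
  let psi := fun x : R => (derive1 phi x) ^+ 2 in
  polish R Omega ->
  markov_process Pr Z ->
  stationary Pr Z mu ->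
  reversible Pr Z mu ->
  0 < alpha ->
  trace_poincare Pr Z mu alpha ->
  (forall x : R, derivable phi x 1) ->
  convex_function (setT : set R^o) psi ->
  (forall (n : nat) (f : borel Omega -> 'M[R[i]]_n),
     suitable Pr Z mu phi psi f ->
     rtr (dirichlet Pr Z mu (mxfun phi \o f)) =
       \int[mu]_z rtr (carre_du_champ Pr Z (mxfun phi \o f) z) /\
     \int[mu]_z rtr (carre_du_champ Pr Z (mxfun phi \o f) z) <=
       \int[mu]_z rtr (carre_du_champ Pr Z f z *m mxfun psi (f z))) /\
  (forall (n : nat) (g : borel Omega * borel Omega -> 'M[R[i]]_n),
     biv_suitable Pr Z mu phi psi g ->
     rtr (biv_dirichlet Pr Z mu (mxfun phi \o g)) =
       \int[(mu \x mu)%E]_z rtr (biv_carre_du_champ Pr Z (mxfun phi \o g) z) /\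
     \int[(mu \x mu)%E]_z rtr (biv_carre_du_champ Pr Z (mxfun phi \o g) z) <=
       \int[(mu \x mu)%E]_z rtr (biv_carre_du_champ Pr Z g z *m mxfun psi (g z))).
Proof.
move=> psi polishO [mZ Z0 _] st rev _ _ dphi cpsi.
have mset1 z := polish_measurable_set1 R Omega z polishO.
split=> n f sf; split.
- by have [_ rf _] := sf; exact: (rtr_dirichlet Pr Z mu mZ st n _ rf).
- exact: (carre_du_champ_chain_le Pr Z mu mZ Z0 st rev mset1 phi psi dphi
    (fun=> erefl) cpsi n f sf).
- by have [_ rf _ _ _] := sf; exact: (rtr_biv_dirichlet Pr Z mu mZ st n _ rf).
- exact: (biv_carre_du_champ_chain_le Pr Z mu mZ st Z0 rev mset1 phi psi dphi
    (fun=> erefl) cpsi n f sf).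
Qed.
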